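(* For a virtual link $L$ represented by a virtual link diagram $D$ with $n$ arcs, let $\widetilde Q(L)$ be the quandle defined in the context. Then $\widetilde Q(L)$ is an invariant of virtual links, i.e. its isomorphism class does not depend on the choice of the diagram $D$ representing $L$.
   Context: A quandle is a set with a binary operation $*$ such that $a*a=a$; each map $b\mapsto b*a$ is a bijection (write $a*^{-1}b$ for the preimage of $a$ under $x\mapsto x*b$); and $(a*b)*c=(a*c)*(b*c)$. The trivial quandle $T_n$ on $\{y_1,\dots,y_n\}$ has $a*b=a$. $FQ_n$ denotes the free quandle on $x_1,\dots,x_n$, and $FQ_n*T_n$ the free product of quandles, which equals the quotient of the free quandle on $x_1,\dots,x_n,y_1,\dots,y_n$ by the relations $y_r*y_s=y_r$ for all $r,s$. Virtual link diagrams: regular immersions of oriented circles with positive, negative or virtual crossings, up to planar isotopy and the generalized Reidemeister moves $R_1,R_2,R_3,VR_1,VR_2,VR_3,VR_4$. An arc is a strand from one crossing (classical or virtual) to the next. Label the $n$ arcs of $D$ by pairs $(x_k,y_k)$, $k=1,\dots,n$. At each crossing drawn with both strands oriented downward, let $(x_i,y_i),(x_j,y_j)$ be the labels of the upper (incoming) arcs from left to right and $(x_p,y_p),(x_q,y_q)$ those of the lower (outgoing) arcs from left to right. Then $\widetilde Q(L)$ is the quotient of $FQ_n*T_n$ by the relations: at a positive crossing $x_p=x_j$, $x_q=x_i*x_j$, $y_p=y_j$, $y_q=y_i$; at a negative crossing $x_p=x_j*^{-1}x_i$, $x_q=x_i$, $y_p=y_j$, $y_q=y_i$; at a virtual crossing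 $x_p=x_j*^{-1}y_i$, $x_q=x_i*y_j$, $y_p=y_j$, $y_q=y_i$. *)

(* Defs.v *)
From Stdlib Require Import ClassicalEpsilon FunctionalExtensionality
  PropExtensionality ProofIrrelevance Relation_Operators.
From HB Require Import structures.
From mathcomp Require Import all_boot.

Set Implicit Arguments.
Unset Strict Implicit.
Unset Printing Implicit Defensive.

Record quandle := Quandle {
  qcar :> Type;
  qop : qcar -> qcar -> qcar;
  qop_idem : forall a, qop a a = a;
  qop_bij : forall a, bijective (fun b => qop b a);
  qop_dist : forall a b c, qop (qop a b) c = qop (qop a c) (qop b c)
}.

Definition quandle_iso (Q1 Q2 : quandle) : Prop :=
  exists f : Q1 -> Q2, bijective f /\
    forall a b, f (qop a b) = qop (f a) (f b).

Inductive qterm (G : Type) : Type :=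
| Gen : G -> qterm G
| Op  : qterm G -> qterm G -> qterm G
| Inv : qterm G -> qterm G -> qterm G.
Arguments Gen {G}.
Arguments Op {G}.
Arguments Inv {G}.

(** The least congruence containing the quandle axioms and the
    relations R: its quotient is the quandle presented by <G | R>,
    i.e. the free quandle on G modulo the relations R. *)
Inductive qcong (G : Type) (R : qterm G -> qterm G -> Prop) :
    qterm G -> qterm G -> Prop :=
| qc_rel s t : R s t -> qcong R s t
| qc_refl s : qcong R s s
| qc_sym s t : qcong R s t -> qcong R t s
| qc_trans s t u : qcong R s t -> qcong R t u -> qcong R s u
| qc_op s s' t t' : qcong R s s' -> qcong R t t' -> qcong R (Op s t) (Op s' t')
| qc_inv s s' t t' : qcong R s s' -> qcong R t t' -> qcong R (Inv s t) (Inv s' t')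
| qc_idem a : qcong R (Op a a) a
| qc_opinv a b : qcong R (Op (Inv a b) b) a
| qc_invop a b : qcong R (Inv (Op a b) b) a
| qc_dist a b c : qcong R (Op (Op a b) c) (Op (Op a c) (Op b c)).

Section Presented.
Variables (G : Type) (R : qterm G -> qterm G -> Prop).

Definition pcls := {P : qterm G -> Prop | exists t, P = qcong R t}.
Definition pclass (t : qterm G) : pcls := exist _ (qcong R t) (ex_intro _ t erefl).
Definition prep (c : pcls) : qterm G :=
  proj1_sig (constructive_indefinite_description _ (proj2_sig c)).

Lemma pclassK c : pclass (prep c) = c.
Proof.
rewrite /prep; case: (constructive_indefinite_description _ _) => t Ht /=.
case: c Ht => P HP /= Ht; subst P; exact: subset_eq_compat.
Qed.

Lemma pclass_eq s t : qcong R s t -> pclass s = pclass t.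
Proof.
move=> Hst; apply: subset_eq_compat; apply: functional_extensionality => u.
apply: propositional_extensionality; split => H.
- exact: qc_trans (qc_sym Hst) H.
- exact: qc_trans Hst H.
Qed.

Definition pop (c d : pcls) : pcls := pclass (Op (prep c) (prep d)).
Definition pinv (c d : pcls) : pcls := pclass (Inv (prep c) (prep d)).

Lemma prep_cong t : qcong R (prep (pclass t)) t.
Proof.
have E := f_equal (@proj1_sig _ _) (pclassK (pclass t)).
change ((proj1_sig (pclass (prep (pclass t)))) t); rewrite E; exact: qc_refl.
Qed.

Lemma pop_class s t : pop (pclass s) (pclass t) = pclass (Op s t).
Proof. by apply: pclass_eq; apply: qc_op; apply: prep_cong. Qed.

Lemma pinv_class s t : pinv (pclass s) (pclass t) = pclass (Inv s t).
Proof. by apply: pclass_eq; apply: qc_inv; apply: prep_cong. Qed.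

Lemma pop_idem a : pop a a = a.
Proof.
by rewrite -(pclassK a) pop_class; apply: pclass_eq; exact: qc_idem.
Qed.

Lemma pop_bij a : bijective (fun b => pop b a).
Proof.
exists (fun b => pinv b a) => b /=.
- rewrite -(pclassK a) -(pclassK b) pop_class pinv_class.
  by apply: pclass_eq; exact: qc_invop.
- rewrite -(pclassK a) -(pclassK b) pinv_class pop_class.
  by apply: pclass_eq; exact: qc_opinv.
Qed.

Lemma pop_dist a b c : pop (pop a b) c = pop (pop a c) (pop b c).
Proof.
rewrite -(pclassK a) -(pclassK b) -(pclassK c) !pop_class.
by apply: pclass_eq; exact: qc_dist.
Qed.

Definition presented : quandle := Quandle pop_idem pop_bij pop_dist.

End Presented.

Inductive ckind := Pos | Neg | Virt.

Definition ckind_eqb (a b : ckind) : bool :=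
  match a, b with
  | Pos, Pos | Neg, Neg | Virt, Virt => true
  | _, _ => false
  end.
Lemma ckind_eqP : Equality.axiom ckind_eqb.
Proof. by case; case; constructor. Qed.
HB.instance Definition _ := hasDecEq.Build ckind ckind_eqP.

(** A passage of a strand through a crossing: (crossing id, crossing
    type, role).  Drawing the crossing with both strands oriented
    downward, role [true] ("A") is the strand going from the upper left
    to the lower right (upper arc i, lower arc q), role [false] ("B")
    is the strand going from the upper right to the lower left (upper
    arc j, lower arc p).  At a positive crossing the B strand is the
    over strand; at a negative crossing the A strand is over. *)
Definition passage := (nat * ckind * bool)%type.
Definition pid (p : passage) : nat := p.1.1.
Definition pkind (p : passage) : ckind := p.1.2.
Definition prole (p : passage) : bool := p.2.

(** A diagram: one cyclic sequence of passages for each (oriented)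
    component, listing in order the crossings (classical or virtual)
    met while travelling along the component. *)
Definition diagram := seq (seq passage).

Definition wf_diagram (D : diagram) : Prop :=
  forall p, p \in flatten D ->
    [/\ count (fun q => (pid q == pid p) && prole q) (flatten D) = 1,
        count (fun q => (pid q == pid p) && ~~ prole q) (flatten D) = 1 &
        forall q, q \in flatten D -> pid q = pid p -> pkind q = pkind p].

(** ** Arcs.  The arc (c, k) of component c is the strand from its k-th
    passage to the next one (cyclically); a component without any
    crossing consists of the single arc (c, 0). *)
Definition comp (D : diagram) (c : nat) : seq passage := nth [::] D c.

Definition is_arc (D : diagram) (a : nat * nat) : bool :=
  (a.1 < size D) && (a.2 < maxn 1 (size (comp D a.1))).

Definition arc (D : diagram) := {a : nat * nat | is_arc D a}.

Definition in_arc (D : diagram) (c k : nat) : nat * nat :=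
  (c, (k + size (comp D c)).-1 %% size (comp D c)).
Definition out_arc (D : diagram) (c k : nat) : nat * nat := (c, k).

(** Generators of FQ_n * T_n: x_a (left) and y_a (right) for each arc a. *)
Definition gen (D : diagram) := (arc D + arc D)%type.
Definition xg {D : diagram} (a : arc D) : qterm (gen D) := Gen (inl a).
Definition yg {D : diagram} (a : arc D) : qterm (gen D) := Gen (inr a).

(** Relations at a crossing of type kd with upper arcs i (left), j (right)
    and lower arcs p (left), q (right). *)
Definition crossing_rel (D : diagram) (kd : ckind) (i j p q : arc D)
    (s t : qterm (gen D)) : Prop :=
  [\/ match kd with
      | Pos => (s = xg p /\ t = xg j) \/ (s = xg q /\ t = Op (xg i) (xg j))
      | Neg => (s = xg p /\ t = Inv (xg j) (xg i)) \/ (s = xg q /\ t = xg i)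
      | Virt => (s = xg p /\ t = Inv (xg j) (yg i)) \/
                (s = xg q /\ t = Op (xg i) (yg j))
      end,
      s = yg p /\ t = yg j |
      s = yg q /\ t = yg i].

Definition dpass : passage := (0, Pos, true).

(** All defining relations of Q~(L): the relations y_r * y_s = y_r of the
    trivial quandle T_n, and the crossing relations. *)
Inductive qtrel (D : diagram) : qterm (gen D) -> qterm (gen D) -> Prop :=
| qt_triv (r s : arc D) : qtrel (Op (yg r) (yg s)) (yg r)
| qt_cross (c1 k1 c2 k2 x : nat) (kd : ckind) (i j p q : arc D) s t :
    k1 < size (comp D c1) -> k2 < size (comp D c2) ->
    nth dpass (comp D c1) k1 = (x, kd, true) ->
    nth dpass (comp D c2) k2 = (x, kd, false) ->
    sval i = in_arc D c1 k1 -> sval q = out_arc D c1 k1 ->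
    sval j = in_arc D c2 k2 -> sval p = out_arc D c2 k2 ->
    crossing_rel kd i j p q s t -> qtrel s t.

Definition Qtilde (D : diagram) : quandle := presented (@qtrel D).

(** A template is a diagram with holes (numbered) along its strands;
    [fill T B] inserts the block of passages [B h] at hole h. *)
Definition template := seq (seq (passage + nat)).

Definition fill (T : template) (B : nat -> seq passage) : diagram :=
  map (fun s => flatten (map (fun e => match e with
                                       | inl p => [:: p]
                                       | inr h => B h end) s)) T.

Definition template_ok (m : nat) (T : template) : Prop :=
  forall h, count (pred1 (inr h)) (flatten T) = nat_of_bool (h < m).

Definition template_fresh (T : template) (ids : seq nat) : Prop :=
  forall e, e \in flatten T ->
    match e with inl p => pid p \notin ids | inr _ => true end.

Definition mkp (x : nat) (k : ckind) (r : bool) : passage := (x, k, r).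

(** R1 / VR1: a kink (curl) on one strand. *)
Definition move1 (B B' : nat -> seq passage) (ids : seq nat) : Prop :=
  exists x k r, ids = [:: x] /\ B 0 = [::] /\
    B' 0 = [:: mkp x k r; mkp x k (~~ r)].

(** R2 / VR2: two strands (hole 0, hole 1) forming a bigon, with
    crossings x, y; in the classical case the same strand is over at
    both crossings (so the types are opposite).  Strands parallel or
    antiparallel. *)
Definition r2_kinds (k k' : ckind) : bool :=
  [|| (k == Pos) && (k' == Neg), (k == Neg) && (k' == Pos)
    | (k == Virt) && (k' == Virt)].

Definition move2 (B B' : nat -> seq passage) (ids : seq nat) : Prop :=
  exists x y k k' r, [/\ ids = [:: x; y] /\ x != y, r2_kinds k k',
    B 0 = [::] /\ B 1 = [::],
    B' 0 = [:: mkp x k r; mkp y k' (~~ r)] &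
    (B' 1 = [:: mkp x k (~~ r); mkp y k' r]       (* parallel strands *)
     \/ B' 1 = [:: mkp y k' r; mkp x k (~~ r)])]. (* antiparallel strands *)

(** R3 / VR3 / VR4: three strands a, b, c (holes 0, 1, 2) bounding a
    triangle with vertices P (on c and a), Q (on a and b), R (on b and c),
    in counterclockwise order.  ea (resp. eb, ec) says whether strand a
    (resp. b, c) runs along the boundary of the triangle counterclockwise.
    This determines the roles of the strands at each crossing and the
    order in which each strand meets its two crossings; the move reverses
    these orders and keeps types and roles. *)
Definition over_is_A (k : ckind) : bool := k == Neg.

Definition r3_kinds (kP kQ kR : ckind) (raQ rbR rcP : bool) : bool :=
  let oQ := raQ == over_is_A kQ in   (* a over b at Q *)
  let oR := rbR == over_is_A kR in   (* b over c at R *)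
  let oP := rcP == over_is_A kP in   (* c over a at P *)
  [|| (* R3: all classical, heights consistent (no cyclic over relation) *)
      [&& kP != Virt, kQ != Virt, kR != Virt & ~~ ((oQ == oR) && (oR == oP))],
      [&& kP == Virt, kQ == Virt & kR == Virt]
    | (* VR4: one strand crosses the two others virtually *)
      [|| [&& kP == Virt, kR == Virt & kQ != Virt],
          [&& kQ == Virt, kP == Virt & kR != Virt]
        | [&& kR == Virt, kQ == Virt & kP != Virt]]].

Definition move3 (B B' : nat -> seq passage) (ids : seq nat) : Prop :=
  exists (xP xQ xR : nat) (kP kQ kR : ckind) (ea eb ec : bool),
  let raQ := ea != eb in let rbQ := ~~ raQ in
  let rbR := eb != ec in let rcR := ~~ rbR in
  let rcP := ec != ea in let raP := ~~ rcP in
  let Pa := mkp xP kP raP in let Pc := mkp xP kP rcP in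
  let Qa := mkp xQ kQ raQ in let Qb := mkp xQ kQ rbQ in
  let Rb := mkp xR kR rbR in let Rc := mkp xR kR rcR in
  [/\ ids = [:: xP; xQ; xR] /\ uniq ids, r3_kinds kP kQ kR raQ rbR rcP,
      B 0 = (if ea then [:: Pa; Qa] else [:: Qa; Pa]),
      B 1 = (if eb then [:: Qb; Rb] else [:: Rb; Qb]) /\
      B 2 = (if ec then [:: Rc; Pc] else [:: Pc; Rc]) &
      [/\ B' 0 = rev (B 0), B' 1 = rev (B 1) & B' 2 = rev (B 2)]].

Definition local_move (m : nat) (B B' : nat -> seq passage) (ids : seq nat)
  : Prop :=
  [\/ m = 1 /\ move1 B B' ids, m = 2 /\ move2 B B' ids |
      m = 3 /\ move3 B B' ids].

(** One elementary step between (well-formed) diagrams: a generalized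
    Reidemeister move, or a change of the combinatorial description that
    does not change the diagram (base points of components, order of
    components, names of crossings). *)
Definition vstep (D D' : diagram) : Prop :=
  [/\ wf_diagram D, wf_diagram D' &
   [\/ exists m T B B' ids, [/\ local_move m B B' ids, template_ok m T,
          template_fresh T ids & D = fill T B /\ D' = fill T B'],
       exists c k, c < size D /\ D' = set_nth [::] D c (rot k (nth [::] D c)),
       perm_eq D D' |
       exists f : nat -> nat, injective f /\
         D' = map (map (fun p : passage => (f (pid p), pkind p, prole p))) D]].

Definition vequiv : diagram -> diagram -> Prop := clos_refl_sym_trans _ vstep.

(* Main.v *)
From Stdlib Require Import ClassicalEpsilon.
Require Import Defs.
From HB Require Import structures.
From mathcomp Require Import all_boot.

(** A colouring of a diagram D in a quandle Q labels each arc by a pair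
    (x, y) in Q so that the relations of [Qtilde D] hold; [Qtilde D] carries the
    universal colouring.  Call two colourings of D and D' compatible when they
    agree away from the part of the diagram that is modified.  If, in every Q,
    each colouring of D is compatible with exactly one colouring of D' and
    conversely, and compatibility is preserved by homomorphisms, then the
    universal colourings induce mutually inverse homomorphisms between
    [Qtilde D] and [Qtilde D'].  So each move only has to be checked on the
    colours of the strands entering and leaving it, where it amounts to
    identities between left-normed words in Q; virtual crossings use that the
    actions of the y-labels commute. *)

Set Implicit Arguments.
Unset Strict Implicit.
Unset Printing Implicit Defensive.

(** * Quandle identities behind the moves *)

Section QuandleTheory.
Variable Q : quandle.
Implicit Types a b c : Q.

Lemma qop_surj a b : exists c, qop c b = a.
Proof. by case: (qop_bij b) => g _ gK; exists (g a); rewrite gK. Qed.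

(** [bijective] only asserts that an inverse exists, so a preimage is chosen; injectivity makes it
    unique. *)
Definition qinv a b : Q :=
  proj1_sig (constructive_indefinite_description _ (qop_surj a b)).

Lemma qopI b : injective (fun a => qop a b).
Proof. exact: bij_inj (qop_bij b). Qed.

Lemma qinvK a b : qop (qinv a b) b = a.
Proof. exact: (proj2_sig (constructive_indefinite_description _ (qop_surj a b))). Qed.

Lemma qopK a b : qinv (qop a b) b = a.
Proof. by apply: (@qopI b) => /=; rewrite qinvK. Qed.

Lemma qinv_idem a : qinv a a = a.
Proof. by rewrite -{1}(qop_idem a) qopK. Qed.

(** Right translation by [qop b c] is the translation by [b] conjugated by the one by [c]. This and
    the next three identities flatten compound right arguments into left-normed words. *)
Lemma qop_opr a b c : qop a (qop b c) = qop (qop (qinv a c) b) c.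
Proof. by rewrite qop_dist qinvK. Qed.

Lemma qinv_opr a b c : qinv a (qop b c) = qop (qinv (qinv a c) b) c.
Proof. by apply: (@qopI (qop b c)) => /=; rewrite qinvK -qop_dist !qinvK. Qed.

Lemma qop_invr a b c : qop a (qinv b c) = qinv (qop (qop a c) b) c.
Proof. by apply: (@qopI c) => /=; rewrite qop_dist !qinvK. Qed.

Lemma qinv_invr a b c : qinv a (qinv b c) = qinv (qinv (qop a c) b) c.
Proof.
by apply: (@qopI (qinv b c)) => /=; rewrite qinvK qop_invr !qinvK qopK.
Qed.

(** If [b] fixes [c], self-distributivity says that the two right translations commute. This and its
    two variants with inverses are applied to y-labels. *)
Lemma qop_comm a b c : qop c b = c -> qop (qop a b) c = qop (qop a c) b.
Proof. by move=> cb; rewrite [RHS]qop_dist cb. Qed.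

Lemma qopinv_comm a b c :
  qop c b = c -> qop (qinv a b) c = qinv (qop a c) b.
Proof.
by move=> cb; apply: (@qopI b) => /=; rewrite qinvK -qop_comm // qinvK.
Qed.

Lemma qinvinv_comm a b c :
  qop c b = c -> qinv (qinv a b) c = qinv (qinv a c) b.
Proof.
move=> cb; apply: (@qopI c) => /=.
by rewrite qinvK qopinv_comm // qinvK.
Qed.

(** Rewriting system: make words left-normed, then cancel inverse translations and self-actions. *)
Definition qnorm :=
  (qop_opr, qinv_opr, qop_invr, qinv_invr, qopK, qinvK, qop_idem, qinv_idem).

End QuandleTheory.

(* [state Q] is the type of labels (x, y) of an arc; a passage is coloured by
   the labels of its incoming and outgoing arcs. *)
Notation state Q := (qcar Q * qcar Q)%type.
Notation pstate Q := (state Q * state Q)%type.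

(** [A] and [B] are the passages of role [true] and [false]; [A.1], [B.1], [B.2], [A.2] are the
    labels of the arcs i, j, p, q. *)
Definition crossing_ok (Q : quandle) (kd : ckind) (A B : pstate Q) : Prop :=
  [/\ B.2.2 = B.1.2, A.2.2 = A.1.2 &
      match kd with
      | Pos => B.2.1 = B.1.1 /\ A.2.1 = qop A.1.1 B.1.1
      | Neg => B.2.1 = qinv B.1.1 A.1.1 /\ A.2.1 = A.1.1
      | Virt => B.2.1 = qinv B.1.1 A.1.2 /\ A.2.1 = qop A.1.1 B.1.2
      end].

Definition crossing_ok_at (Q : quandle) kd (r : bool) (u v : pstate Q) : Prop :=
  if r then crossing_ok kd u v else crossing_ok kd v u.

(* States before and after the two passages of a strand going through [i], [m],
   [o]: [e] tells in which order the strand meets them. *)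
Definition fst_edge (Q : quandle) (e : bool) (i m o : state Q) : pstate Q :=
  if e then (i, m) else (m, o).
Definition snd_edge (Q : quandle) (e : bool) (i m o : state Q) : pstate Q :=
  if e then (m, o) else (i, m).

Definition kink_ok (Q : quandle) k r (i m o : state Q) :=
  crossing_ok_at k r (i, m) (m, o).

Lemma kink_exists (Q : quandle) k r (i : state Q) : exists m, kink_ok k r i m i.
Proof.
rewrite /kink_ok /crossing_ok_at /crossing_ok; case: i => x y.
case: k r => [] [] /=.
- by exists (x, y); rewrite qop_idem.
- by exists (x, y); rewrite qop_idem.
- by exists (x, y); rewrite qinv_idem.
- by exists (x, y); rewrite qinv_idem.
- by exists (qop x y, y); rewrite /= qopK.
- by exists (qinv x y, y); rewrite /= qinvK.
Qed.

(** At a classical kink idempotency forces all three states to agree; at a virtual one the strand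
    acts on itself by its own y-label and then undoes this action. *)
Lemma kink_unique (Q : quandle) k r (i m o : state Q) :
  kink_ok k r i m o ->
  o = i /\ m = if k is Virt then ((if r then qop i.1 i.2 else qinv i.1 i.2), i.2) else i.
Proof.
rewrite /kink_ok /crossing_ok_at /crossing_ok; case: i m o => x y [x1 y1] [x2 y2].
(* When the kink passes under first, the middle label occurs on both sides of its own relation;
   these two facts solve that equation. *)
have fix1 (a b : Q) : b = qop a b -> a = b.
  by rewrite -{1}(qop_idem b) => /qopI.
have fix2 (a b : Q) : b = qinv a b -> a = b.
  by rewrite -{1}(qinv_idem b) => /(congr1 (@qop Q ^~ b)); rewrite !qinvK.
case: k r => [] [] /= [e1 e2 [e3 e4]]; subst; rewrite ?qnorm //.
- by rewrite (fix1 _ _ e4).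
- by rewrite (fix2 _ _ e3).
Qed.

(** [par] tells whether the second strand meets the two crossings in the same order as the first. *)
Definition bigon_ok (Q : quandle) (par : bool) k k' r
    (i0 m0 o0 i1 m1 o1 : state Q) :=
  crossing_ok_at k r (i0, m0) (fst_edge par i1 m1 o1) /\
  crossing_ok_at k' (~~ r) (m0, o0) (snd_edge par i1 m1 o1).

Lemma bigon_exists (Q : quandle) par k k' r (i0 i1 : state Q) :
  r2_kinds k k' -> exists m0 m1, bigon_ok par k k' r i0 m0 i0 i1 m1 i1.
Proof.
rewrite /bigon_ok /fst_edge /snd_edge /crossing_ok_at /crossing_ok; case: i0 i1 => x y [z t].
case: par k k' r => [] [] [] [] //= _;
  (* The middle labels are existential variables, instantiated by unification with the crossing
     relations; what remains are cancellations. *)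
  do 2 eexists (_, _); split; split=> /=; try reflexivity; split; try reflexivity;
  by rewrite ?qnorm.
Qed.

Lemma bigon_unique (Q : quandle) par k k' r (i0 m0 o0 i1 m1 o1 m0' m1' : state Q) :
  r2_kinds k k' -> bigon_ok par k k' r i0 m0 o0 i1 m1 o1 ->
  [/\ i0 = o0, i1 = o1 & bigon_ok par k k' r i0 m0' o0 i1 m1' o1 ->
   m0 = m0' /\ m1 = m1'].
Proof.
rewrite /bigon_ok /fst_edge /snd_edge /crossing_ok_at /crossing_ok.
case: i0 m0 o0 i1 m1 o1 m0' m1' => [? ?] [? ?] [? ?] [? ?] [? ?] [? ?] [? ?] [? ?].
case: par; case: k; case: k'; case: r => //= _ [] [e1 e2 [e3 e4]] [e5 e6 [e7 e8]]; subst;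
  rewrite ?qnorm; (split; last (move=> [] [f1 f2 [f3 f4]] [f5 f6 [f7 f8]]; subst)); by rewrite ?qnorm.
Qed.

Definition triangle_ok (Q : quandle) kP kQ kR raQ rbR rcP (ea eb ec : bool)
    (ia ma oa ib mb ob ic mc oc : state Q) :=
  [/\ crossing_ok_at kQ raQ (snd_edge ea ia ma oa) (fst_edge eb ib mb ob),
      crossing_ok_at kR rbR (snd_edge eb ib mb ob) (fst_edge ec ic mc oc) &
      crossing_ok_at kP rcP (snd_edge ec ic mc oc) (fst_edge ea ia ma oa)].

(** After the move each strand meets its crossings in the opposite order, with the same outer
    states. For classical crossings this is self-distributivity; where a strand crosses two others
    virtually, two y-labels act in exchanged order. The hypotheses mention incoming y-labels only,
    since crossings preserve them. *)
Lemma triangle_flip (Q : quandle) kP kQ kR (ea eb ec : bool)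
    (ia ma oa ib mb ob ic mc oc : state Q) :
  r3_kinds kP kQ kR (ea != eb) (eb != ec) (ec != ea) ->
  [/\ qop ia.2 ib.2 = ia.2, qop ib.2 ic.2 = ib.2 & qop ic.2 ia.2 = ic.2] ->
  [/\ qop ib.2 ia.2 = ib.2, qop ic.2 ib.2 = ic.2 & qop ia.2 ic.2 = ia.2] ->
  triangle_ok kP kQ kR (ea != eb) (eb != ec) (ec != ea) ea eb ec
    ia ma oa ib mb ob ic mc oc ->
  exists ma' mb' mc',
    triangle_ok kP kQ kR (ea != eb) (eb != ec) (ec != ea)
      (~~ ea) (~~ eb) (~~ ec) ia ma' oa ib mb' ob ic mc' oc.
Proof.
rewrite /triangle_ok /fst_edge /snd_edge /crossing_ok_at /crossing_ok.
case: ia ma oa ib mb ob ic mc oc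
  => [? ?] [? ?] [? ?] [? ?] [? ?] [? ?] [? ?] [? ?] [? ?].
case: ea; case: eb; case: ec; case: kP; case: kQ; case: kR => //= _;
  case=> tab tbc tca [tba tcb tac];
  move=> [[e1 e2 [e3 e4]] [e5 e6 [e7 e8]] [e9 e10 [e11 e12]]]; subst;
  (* Equations with an existential variable on the left define the middle labels and are solved
     first. *)
  do 3 eexists (_, _); split; split=> /=;
  try match goal with |- _ /\ _ => split end;
  try match goal with |- ?m = _ => is_evar m; reflexivity end;
  rewrite ?qnorm //;
  (* The left-normed words now differ at most by the order of two y-actions. *)
  first [ exact: qop_comm | exact: qopinv_comm | exact: qinvinv_comm
        | symmetry; exact: qopinv_comm ].
Qed.

(** Both colourings share the exits as well as the entries, so the middle labels can be solved for
    from either end of each strand. *)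
Lemma triangle_unique (Q : quandle) kP kQ kR (ea eb ec : bool)
    (ia ma oa ib mb ob ic mc oc ma' mb' mc' : state Q) :
  r3_kinds kP kQ kR (ea != eb) (eb != ec) (ec != ea) ->
  triangle_ok kP kQ kR (ea != eb) (eb != ec) (ec != ea) ea eb ec
    ia ma oa ib mb ob ic mc oc ->
  triangle_ok kP kQ kR (ea != eb) (eb != ec) (ec != ea) ea eb ec
    ia ma' oa ib mb' ob ic mc' oc ->
  [/\ ma = ma', mb = mb' & mc = mc'].
Proof.
rewrite /triangle_ok /fst_edge /snd_edge /crossing_ok_at /crossing_ok.
case: ia ma oa ib mb ob ic mc oc ma' mb' mc'
  => [? ?] [? ?] [? ?] [? ?] [? ?] [? ?] [? ?] [? ?] [? ?] [? ?] [? ?] [? ?].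
case: ea; case: eb; case: ec; case: kP; case: kQ; case: kR => //= _;
  move=> [[e1 e2 [e3 e4]] [e5 e6 [e7 e8]] [e9 e10 [e11 e12]]];
  move=> [[f1 f2 [f3 f4]] [f5 f6 [f7 f8]] [f9 f10 [f11 f12]]].
all: by subst; rewrite ?qnorm.
Qed.

(** * Colourings *)

(** The entries have an arbitrary type, so that the same predicate applies to passages and to
    template entries. *)
Fixpoint walk (Q : quandle) (E : Type) (st : E -> pstate Q)
    (s s' : state Q) (l : seq E) : Prop :=
  if l is e :: l' then (st e).1 = s /\ walk st (st e).2 s' l' else s = s'.

Section Walk.
Variable Q : quandle.

Lemma walk_cat (E : Type) (st : E -> pstate Q) s s' l1 l2 :
  walk st s s' (l1 ++ l2) <-> exists m, walk st s m l1 /\ walk st m s' l2.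
Proof.
elim: l1 s => [|e l1 IH] s /=; first by split=> [w|[m [-> //]]]; exists s.
split=> [[es /IH[m [w1 w2]]]|[m [[es w1] w2]]]; first by exists m.
by split=> //; apply/IH; exists m.
Qed.

Lemma walk_functional (E : Type) (st : E -> pstate Q) s s1 s2 l :
  walk st s s1 l -> walk st s s2 l -> s1 = s2.
Proof. by elim: l s => [|e l IH] s /= => [<- //|[_ w1] [_ /(IH _ w1)]]. Qed.

Lemma walk_map (E E' : Type) (g : E -> E') (st : E' -> pstate Q) s s' l :
  walk st s s' (map g l) <-> walk (st \o g) s s' l.
Proof. by elim: l s => [|e l IH] s //=; rewrite IH. Qed.

Lemma eq_in_walk (E : eqType) (st st' : E -> pstate Q) s s' (l : seq E) :
  {in l, st =1 st'} -> walk st s s' l -> walk st' s s' l.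
Proof.
elim: l s => [|e l IH] s //= eqst [<- w].
rewrite -eqst ?mem_head //; split=> //; apply: IH w => e' le'.
by rewrite eqst // inE le' orbT.
Qed.

Lemma walk_y (E : eqType) (st : E -> pstate Q) s s' (l : seq E) :
  {in l, forall e, (st e).2.2 = (st e).1.2} -> walk st s s' l -> s'.2 = s.2.
Proof.
elim: l s => [|e l IH] s /= ycst => [-> //|[<- /IH->]].
  by rewrite ycst ?mem_head.
by move=> e' le'; rewrite ycst // inE le' orbT.
Qed.

Lemma walkP (E : Type) (st : E -> pstate Q) e0 s s' l :
  walk st s s' l <->
  (forall k, k < size l ->
     (st (nth e0 l k)).1 = if k is k'.+1 then (st (nth e0 l k')).2 else s) /\
  s' = if size l is n.+1 then (st (nth e0 l n)).2 else s.
Proof.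
elim: l s => [|e l IH] s /=; first by split=> [->|[_ ->]].
split=> [[es /IH[wk ws']]|[wk ws']].
  split=> [[//|k]|]; last by rewrite ws'; case: (size l).
  by rewrite ltnS /= => /wk ->; case: k.
split; first exact: (wk 0).
apply/IH; split=> [k lt_k|]; last by rewrite ws'; case: (size l).
by rewrite (wk k.+1) //; case: k {lt_k}.
Qed.

(** If the state before an entry determines the state after it, the initial state propagates along
    the whole walk. *)
Lemma walk_unique (E : eqType) (st st' : E -> pstate Q) s s1 s2 (l : seq E) :
  {in l, forall e, (st e).1 = (st' e).1 -> st e = st' e} ->
  walk st s s1 l -> walk st' s s2 l -> {in l, st =1 st'}.
Proof.
elim: l s => [|e l IH] s //= det [es w] [es' w'].
have eqe : st e = st' e by apply: det; rewrite ?mem_head // es.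
rewrite -eqe in w'.
move=> e'; rewrite inE => /predU1P[-> //|le']; apply: IH w w' _ le' => e1 le1.
by apply: det; rewrite inE le1 orbT.
Qed.

End Walk.

(* A colouring records the state at the base point of each component and the
   states before and after each passage. *)
Notation coll Q := ((nat -> state Q) * (passage -> pstate Q))%type.

Definition passage_ok (Q : quandle) (st : passage -> pstate Q) (p : passage) :=
  crossing_ok (pkind p) (st (pid p, pkind p, true)) (st (pid p, pkind p, false)).

Lemma passage_ok_y (Q : quandle) (st : passage -> pstate Q) p :
  passage_ok st p -> (st p).2.2 = (st p).1.2.
Proof. by case: p => [[x kd] []] []. Qed.

Lemma eq_passage_ok (Q : quandle) (st st' : passage -> pstate Q) p :
  (forall r, st (pid p, pkind p, r) = st' (pid p, pkind p, r)) ->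
  passage_ok st p -> passage_ok st' p.
Proof. by move=> eqst; rewrite /passage_ok !eqst. Qed.

(** The base point state is the only label of a component without crossings. Triviality is required
    at base points only: y-labels are constant along a component. *)
Record coloring (D : diagram) (Q : quandle) (f : coll Q) : Prop := Coloring {
  col_walk : forall i, i < size D -> walk f.2 (f.1 i) (f.1 i) (nth [::] D i);
  col_ok : {in flatten D, forall p, passage_ok f.2 p};
  col_triv : forall i j, i < size D -> j < size D ->
    qop (f.1 i).2 (f.1 j).2 = (f.1 i).2
}.

(** A [coll] is total, so equality is restricted to the components and passages that occur in
    [D]. *)
Definition eq_coll (D : diagram) (Q : quandle) (f g : coll Q) : Prop :=
  (forall i, i < size D -> f.1 i = g.1 i) /\ {in flatten D, f.2 =1 g.2}.

Definition is_hom (Q Q' : quandle) (h : Q -> Q') :=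
  forall a b, h (qop a b) = qop (h a) (h b).

Definition smap (Q Q' : quandle) (h : Q -> Q') (s : state Q) : state Q' :=
  (h s.1, h s.2).
Definition psmap (Q Q' : quandle) (h : Q -> Q') (s : pstate Q) : pstate Q' :=
  (smap h s.1, smap h s.2).
Definition cmap (Q Q' : quandle) (h : Q -> Q') (f : coll Q) : coll Q' :=
  (fun i => smap h (f.1 i), fun p => psmap h (f.2 p)).

Lemma cmap_passage (Q Q' : quandle) (h : Q -> Q') (f : coll Q) p :
  (cmap h f).2 p = psmap h (f.2 p).
Proof. by []. Qed.

Section Hom.
Variables (Q Q' : quandle) (h : Q -> Q').
Hypothesis hM : is_hom h.

Lemma hom_inv a b : h (qinv a b) = qinv (h a) (h b).
Proof. by apply: (@qopI _ (h b)) => /=; rewrite qinvK -hM qinvK. Qed.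

Lemma hom_walk (E : Type) (st : E -> pstate Q) s s' l :
  walk st s s' l -> walk (psmap h \o st) (smap h s) (smap h s') l.
Proof. by elim: l s => [|e l IH] s /= => [-> //|[<- /IH]]. Qed.

Lemma hom_passage_ok (st : passage -> pstate Q) p :
  passage_ok st p -> passage_ok (psmap h \o st) p.
Proof.
case: p => [[x k] r]; rewrite /passage_ok /crossing_ok /= => -[-> -> e].
split=> //; move: e; rewrite /pkind /=; case: k => -[-> ->];
  by rewrite ?hom_inv ?hM.
Qed.

Lemma hom_coloring D f : coloring D f -> coloring D (cmap h f).
Proof.
case=> cw cok ct; split=> [i /cw /hom_walk //|p /cok /hom_passage_ok //|i j li lj].
by rewrite /= -hM ct.
Qed.

End Hom.

(** * Passages and their positions in a well-formed diagram *)

Lemma wf_uniq (D : diagram) : wf_diagram D -> uniq (flatten D).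
Proof.
move=> wfD; apply: count_mem_uniq => p; case: (boolP (p \in flatten D)); last by move/count_memPn.
move=> Dp; apply/eqP; rewrite eqn_leq -has_count has_pred1 Dp andbT /=.
have [cA cB _] := wfD p Dp.
have [rp|rp] := boolP (prole p); [rewrite -cA | rewrite -cB];
  by apply: sub_count => q /eqP ->; rewrite eqxx rp.
Qed.

Lemma wf_partner (D : diagram) p r : wf_diagram D -> p \in flatten D ->
  (pid p, pkind p, r) \in flatten D.
Proof.
move=> wfD Dp; have [cA cB ck] := wfD p Dp.
have: has (fun q => (pid q == pid p) && (prole q == r)) (flatten D).
  rewrite has_count; case: r.
    by rewrite (eq_count (a2 := fun q => (pid q == pid p) && prole q)) ?cA // => q; rewrite eqb_id.
  by rewrite (eq_count (a2 := fun q => (pid q == pid p) && ~~ prole q)) ?cB // => q; rewrite eqbF_neg.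
case/hasP => q Dq /andP[/eqP pq /eqP rq].
by rewrite -(ck q Dq pq) -pq -rq; move: Dq; case: q {pq rq} => [[x k] r'].
Qed.

Definition position (D : diagram) (p : passage) : nat * nat :=
  (reshape_index (shape D) (index p (flatten D)),
   reshape_offset (shape D) (index p (flatten D))).

Lemma nth_comp_flatten (D : diagram) c k : k < size (nth [::] D c) ->
  nth dpass (flatten D) (flatten_index (shape D) c k) = nth dpass (nth [::] D c) k
  /\ flatten_index (shape D) c k < size (flatten D).
Proof.
move=> lk; have lk' := lk; rewrite -nth_shape in lk'.
rewrite nth_flatten flatten_indexKl // flatten_indexKr //; split=> //.
by rewrite size_flatten flatten_indexP.
Qed.

Lemma mem_comp_flatten (D : diagram) c k : k < size (nth [::] D c) ->
  nth dpass (nth [::] D c) k \in flatten D.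
Proof. by move/nth_comp_flatten => [<- lt]; rewrite mem_nth. Qed.

Lemma position_nth (D : diagram) c k : uniq (flatten D) -> k < size (nth [::] D c) ->
  position D (nth dpass (nth [::] D c) k) = (c, k).
Proof.
move=> uD lk; have [<- lt] := nth_comp_flatten lk.
have lk' := lk; rewrite -nth_shape in lk'.
by rewrite /position index_uniq // flatten_indexKl // flatten_indexKr.
Qed.

Lemma mem_flattenP (D : diagram) p : p \in flatten D ->
  exists c k, k < size (nth [::] D c) /\ nth dpass (nth [::] D c) k = p.
Proof.
case/flattenP => s /(nthP [::])[c lc <-] /(nthP dpass)[k lk <-].
by exists c, k.
Qed.

(** * The universal colouring *)

Section Presentation.
Variables (G : Type) (R : qterm G -> qterm G -> Prop).

Lemma qinv_class s t :
  @qinv (presented R) (pclass R s) (pclass R t) = pclass R (Inv s t).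
Proof.
apply: (@qopI (presented R) (pclass R t)); etransitivity; first exact: qinvK.
rewrite [RHS]pop_class; apply: pclass_eq; apply: qc_sym; exact: qc_opinv.
Qed.

Variables (Q : quandle) (g : G -> Q).

Fixpoint qeval (t : qterm G) : Q :=
  match t with
  | Gen x => g x
  | Op s t => qop (qeval s) (qeval t)
  | Inv s t => qinv (qeval s) (qeval t)
  end.

Hypothesis gR : forall s t, R s t -> qeval s = qeval t.

Lemma qeval_cong s t : qcong R s t -> qeval s = qeval t.
Proof.
elim=> {s t} //=.
- by move=> s t u _ -> _ ->.
- by move=> s s' t t' _ -> _ ->.
- by move=> s s' t t' _ -> _ ->.
- by move=> a; rewrite qop_idem.
- by move=> a b; rewrite qinvK.
- by move=> a b; rewrite qopK.
- by move=> a b c; rewrite qop_dist.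
Qed.

(** Evaluation of a chosen representative; by [qeval_cong] the choice is irrelevant. This is the
    universal property of the presented quandle. *)
Definition qlift (c : presented R) : Q := qeval (prep c).

Lemma qlift_class t : qlift (pclass R t) = qeval t.
Proof. exact: qeval_cong (prep_cong R t). Qed.

Lemma qlift_hom : is_hom qlift.
Proof.
by move=> a b; rewrite -(pclassK a) -(pclassK b) [qop _ _]pop_class !qlift_class.
Qed.

End Presentation.

(** Replaces the cyclic arithmetic of [in_arc] by the case distinction of [walkP]. *)
Lemma in_arcE (D : diagram) c k : k < size (nth [::] D c) ->
  in_arc D c k = (c, if k is k'.+1 then k' else (size (nth [::] D c)).-1).
Proof.
rewrite /in_arc /Defs.comp; set n := size _ => lk; congr (_, _).
case: k lk => [|k] lk; first by rewrite add0n modn_small // prednK.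
by rewrite addSn /= modnDr modn_small // ltnW.
Qed.

Lemma comp_is_arc (D : diagram) c k : k < size (nth [::] D c) -> is_arc D (c, k).
Proof.
rewrite /is_arc /Defs.comp /= => lk; rewrite leq_max lk orbT andbT.
by case: (ltnP c (size D)) lk => // lc; rewrite nth_default.
Qed.

Lemma in_arc_is_arc (D : diagram) c k :
  k < size (nth [::] D c) -> is_arc D (in_arc D c k).
Proof.
move=> lk; rewrite in_arcE //; apply: comp_is_arc.
by case: k lk => [|k] lk; [rewrite ltn_predL | exact: ltnW].
Qed.

Section ArcColors.
Variables (D : diagram) (Q : quandle) (f : coll Q).
Hypothesis fD : coloring D f.

(** An arc is named by the passage where it starts, so its label is the outgoing state there; a
    component without passages has only its base point state. *)
Definition acol (a : nat * nat) : state Q :=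
  if nth [::] D a.1 is [::] then f.1 a.1
  else (f.2 (nth dpass (nth [::] D a.1) a.2)).2.

Lemma acol_out c k : k < size (nth [::] D c) ->
  acol (c, k) = (f.2 (nth dpass (nth [::] D c) k)).2.
Proof. by rewrite /acol /=; case: (nth [::] D c). Qed.

(** The base point lies on the closing arc, between the last passage and the first. *)
Lemma acol_base c : c < size D -> acol (c, (size (nth [::] D c)).-1) = f.1 c.
Proof.
move=> lc; have /(walkP _ dpass)[_ ->] := col_walk fD lc.
by rewrite /acol /=; case: (nth [::] D c).
Qed.

Lemma acol_in c k : k < size (nth [::] D c) ->
  acol (in_arc D c k) = (f.2 (nth dpass (nth [::] D c) k)).1.
Proof.
move=> lk; have /andP[/= lc _] := comp_is_arc lk.
have /(walkP _ dpass)[-> // _] := col_walk fD lc.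
rewrite in_arcE //; case: k lk => [|k] lk; first by rewrite acol_base.
by rewrite acol_out // ltnW.
Qed.

(** Induction along the component, each crossing preserving y; this reduces the relations of the
    trivial quandle to base points. *)
Lemma acol_y a : is_arc D a -> (acol a).2 = (f.1 a.1).2.
Proof.
case: a => c k; rewrite /is_arc /Defs.comp /= => /andP[lc lk].
case: (posnP (size (nth [::] D c))) => [/size0nil e|n_gt0].
  by rewrite /acol /= e.
rewrite (maxn_idPr n_gt0) in lk; rewrite acol_out //.
have /(walkP _ dpass)[wk _] := col_walk fD lc.
elim: k lk => [|k IH] lk; rewrite (passage_ok_y (col_ok fD (mem_comp_flatten lk))) wk //.
by rewrite IH // ltnW.
Qed.

Definition gcol (x : gen D) : Q :=
  match x with inl a => (acol (sval a)).1 | inr a => (acol (sval a)).2 end.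

Lemma gcol_rel s t : qtrel s t -> qeval gcol s = qeval gcol t.
Proof.
case=> {s t} [r s /=|c1 k1 c2 k2 x kd i j p q s t l1 l2 n1 n2 Ei Eq Ej Ep].
  have lr := proj2_sig r; have ls := proj2_sig s; rewrite !acol_y //.
  by apply: (col_triv fD); [case/andP: lr | case/andP: ls].
have ok := col_ok fD (mem_comp_flatten l1).
rewrite n1 /passage_ok /pid /pkind /= -n1 -n2 in ok.
have gi : acol (sval i) = (f.2 (nth dpass (nth [::] D c1) k1)).1 by rewrite Ei acol_in.
have gq : acol (sval q) = (f.2 (nth dpass (nth [::] D c1) k1)).2 by rewrite Eq acol_out.
have gj : acol (sval j) = (f.2 (nth dpass (nth [::] D c2) k2)).1 by rewrite Ej acol_in.
have gp : acol (sval p) = (f.2 (nth dpass (nth [::] D c2) k2)).2 by rewrite Ep acol_out.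
case: ok; rewrite -gi -gq -gj -gp /= => yp yq xs.
case=> [|[-> ->]|[-> ->]] //.
by case: kd xs {n1 n2} => -[xp xq] [] [-> ->].
Qed.

End ArcColors.

Section Universal.
Variable D : diagram.
Hypotheses (wfD : wf_diagram D) (D_gt0 : 0 < size D).
Local Notation QD := (Qtilde D).

Lemma arc0_subproof : is_arc D (0, 0).
Proof. by rewrite /is_arc D_gt0 leq_max. Qed.

(** Total version of the inclusion of indices into arcs; the default arc [(0, 0)] is where
    non-emptiness of [D] enters. *)
Definition arc_at (a : nat * nat) : Defs.arc D :=
  insubd (exist (fun a => is_arc D a) (0, 0) arc0_subproof) a.

Lemma sval_arc_at a : is_arc D a -> sval (arc_at a) = a.
Proof. exact: insubdK. Qed.

Lemma arc_atK (a : Defs.arc D) : arc_at (sval a) = a.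
Proof. exact: valKd. Qed.

Definition ucol (a : nat * nat) : state QD :=
  (pclass (@qtrel D) (xg (arc_at a)), pclass (@qtrel D) (yg (arc_at a))).

Definition ust (p : passage) : pstate QD :=
  let ck := position D p in (ucol (in_arc D ck.1 ck.2), ucol ck).

Definition univ : coll QD :=
  (fun c => ucol (c, (size (nth [::] D c)).-1), ust).

Lemma ust_nth c k : k < size (nth [::] D c) ->
  ust (nth dpass (nth [::] D c) k) = (ucol (in_arc D c k), ucol (c, k)).
Proof. by move=> lk; rewrite /ust position_nth // wf_uniq. Qed.

Lemma univ_nth c k : k < size (nth [::] D c) ->
  univ.2 (nth dpass (nth [::] D c) k) = (ucol (in_arc D c k), ucol (c, k)).
Proof. exact: ust_nth. Qed.

Lemma univ_coloring : coloring D univ.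
Proof.
split=> [c lc|p Dp|i j _ _].
- apply/(walkP _ dpass); split=> [k lk|].
    rewrite univ_nth // in_arcE //; case: k lk => [|k] lk //.
    by rewrite univ_nth // ltnW.
  case E: (size _) => [|n]; first by [].
  by rewrite univ_nth ?E // -[in RHS]/(n.+1.-1) -E.
(* Well-formedness supplies both passages of the crossing, and their positions identify its four
   arcs. *)
- have [c1 [k1 [l1 n1]]] := mem_flattenP (wf_partner true wfD Dp).
  have [c2 [k2 [l2 n2]]] := mem_flattenP (wf_partner false wfD Dp).
  rewrite /passage_ok -n1 -n2 !univ_nth //.
  have rel s t : crossing_rel (pkind p) (arc_at (in_arc D c1 k1))
      (arc_at (in_arc D c2 k2)) (arc_at (c2, k2)) (arc_at (c1, k1)) s t ->
      pclass (@qtrel D) s = pclass (@qtrel D) t.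
    move=> cr; apply/pclass_eq/qc_rel; apply: (qt_cross l1 l2 n1 n2) cr;
      by rewrite sval_arc_at ?in_arc_is_arc ?comp_is_arc.
  split; [by apply: rel; constructor 2 | by apply: rel; constructor 3 |].
  move: rel; case: (pkind p) => rel; split; rewrite /= ?qinv_class ?pop_class;
    by apply: rel; constructor 1; auto.
- by rewrite /= pop_class; apply/pclass_eq/qc_rel; exact: qt_triv.
Qed.

(** Existence half of universality: arc colours satisfy the defining relations, hence extend to the
    presented quandle. *)
Lemma univ_lift (Q : quandle) (f : coll Q) : coloring D f ->
  exists h : QD -> Q, is_hom h /\ eq_coll D (cmap h univ) f.
Proof.
move=> fD; exists (qlift (gcol f)); split; first exact: qlift_hom (gcol_rel fD).
have liftc a : is_arc D a -> smap (qlift (gcol f)) (ucol a) = acol D f a.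
  move=> Da; rewrite /smap /= !(qlift_class (gcol_rel fD)) /= sval_arc_at //.
  by rewrite -surjective_pairing.
split=> [c lc|p Dp].
  rewrite [LHS]liftc ?acol_base //.
  by rewrite /is_arc lc leq_max /= /Defs.comp; case: (size _) => //= n; rewrite leqnn orbT.
have [c [k [lk <-]]] := mem_flattenP Dp.
rewrite cmap_passage univ_nth // /psmap !liftc ?in_arc_is_arc ?comp_is_arc //.
by rewrite acol_in // acol_out // -surjective_pairing.
Qed.

(** Uniqueness half: every arc label occurs at a passage or at a base point, and these labels
    generate [QD]. *)
Lemma univ_endo_id (h : QD -> QD) :
  is_hom h -> eq_coll D (cmap h univ) univ -> h =1 id.
Proof.
move=> hM [eqb eqp].
have huc (a : Defs.arc D) : smap h (ucol (sval a)) = ucol (sval a).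
  case: a => -[c k] /= Da; case: (posnP (size (nth [::] D c))) => [n0|n_gt0].
    have /andP[/= lc] := Da; rewrite /Defs.comp n0 ltnS leqn0 => /eqP ->.
    by have := eqb c lc; rewrite /= n0.
  have /andP[/= lc] := Da; rewrite /Defs.comp (maxn_idPr n_gt0) => lk.
  have := eqp _ (mem_comp_flatten lk).
  by rewrite cmap_passage univ_nth // => /(congr1 snd).
move=> c; rewrite -(pclassK c); elim: (prep c) => [[a|a]|s IHs t IHt|s IHs t IHt].
- by have := congr1 fst (huc a); rewrite /= arc_atK.
- by have := congr1 snd (huc a); rewrite /= arc_atK.
- by rewrite -pop_class [LHS]hM IHs IHt.
- by rewrite -qinv_class (hom_inv hM) IHs IHt.
Qed.

End Universal.

(* [A] is the compatibility relation between colourings of D and of D'. *)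
Record transfer (D D' : diagram) (A : forall Q, coll Q -> coll Q -> Prop) : Prop :=
  Transfer {
  tr_exists : forall (Q : quandle) (f : coll Q),
    coloring D f -> exists2 f', coloring D' f' & A Q f f';
  tr_unique : forall (Q : quandle) (f f1 f2 : coll Q),
    coloring D f -> coloring D' f1 -> coloring D' f2 ->
    A Q f f1 -> A Q f f2 -> eq_coll D' f1 f2;
  tr_hom : forall (Q Q' : quandle) (h : Q -> Q') (f f' : coll Q), is_hom h ->
    A Q f f' -> A Q' (cmap h f) (cmap h f');
  tr_ext : forall (Q : quandle) (f g f' : coll Q),
    eq_coll D f g -> A Q f f' -> A Q g f'
}.

Lemma transfer_iso (D D' : diagram) (A : forall Q, coll Q -> coll Q -> Prop) :
  wf_diagram D -> wf_diagram D' -> 0 < size D -> 0 < size D' ->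
  transfer D D' A -> transfer D' D (fun Q f f' => A Q f' f) ->
  quandle_iso (Qtilde D) (Qtilde D').
Proof.
move=> wfD wfD' sD sD' tr tr'.
have cu := univ_coloring wfD sD; have cu' := univ_coloring wfD' sD'.
have [f' cf' Af'] := tr_exists tr cu.
have [f cf Af] := tr_exists tr' cu'.
have [h [hM hE]] := univ_lift wfD' sD' cf'.
have [g [gM gE]] := univ_lift wfD sD cf.
have hgM : is_hom (h \o g) by move=> a b; rewrite /= gM hM.
have ghM : is_hom (g \o h) by move=> a b; rewrite /= hM gM.
have eq_cmap (E : diagram) (Q1 Q2 : quandle) (k : Q1 -> Q2) (u v : coll Q1) :
    eq_coll E u v -> eq_coll E (cmap k v) (cmap k u).
  by case=> ub up; split=> [i li|p Ep] /=; rewrite ?ub ?up.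
exists g; split=> //; exists h => x.
- suff E : eq_coll D (cmap (h \o g) (univ sD)) (univ sD).
    exact: (univ_endo_id wfD hgM E x).
  (* The universal colouring and its image under [h \o g] are both shown compatible with [f']. Up to
     [eq_coll], the second compatibility is the image under [h] of [Af]. *)
  apply: (tr_unique tr' cf' (hom_coloring hgM cu) cu _ Af').
  apply: (tr_ext tr' hE); apply: (tr_ext tr (eq_cmap _ _ _ h _ _ gE)).
  exact: (tr_hom tr hM).
- suff E : eq_coll D' (cmap (g \o h) (univ sD')) (univ sD').
    exact: (univ_endo_id wfD' ghM E x).
  apply: (tr_unique tr cf (hom_coloring ghM cu') cu' _ Af).
  apply: (tr_ext tr gE); apply: (tr_ext tr' (eq_cmap _ _ _ g _ _ hE)).
  exact: (tr_hom tr gM).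
Qed.

(** * Relabellings and changes of base point *)

Lemma eq_transfer (D D' : diagram) (A A' : forall Q, coll Q -> coll Q -> Prop) :
  (forall Q f f', A Q f f' <-> A' Q f f') -> transfer D D' A -> transfer D D' A'.
Proof.
move=> eqA [ex un hm ext]; split.
- by move=> Q f /ex[f' cf' /eqA]; exists f'.
- by move=> Q f f1 f2 cf cf1 cf2 /eqA A1 /eqA; apply: un A1.
- by move=> Q Q' h f f' hM /eqA/(hm _ _ _ _ _ hM)/eqA.
- by move=> Q f g f' fg /eqA/(ext _ _ _ _ fg)/eqA.
Qed.

Lemma mem_flatten_nthP (T : eqType) (ss : seq (seq T)) x :
  reflect (exists2 i, i < size ss & x \in nth [::] ss i) (x \in flatten ss).
Proof.
apply: (iffP flattenP) => [[s /(nthP [::])[i li <-] xs]|[i li xs]].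
  by exists i.
by exists (nth [::] ss i); rewrite ?mem_nth.
Qed.

Definition rename (phi : nat -> nat) (p : passage) : passage :=
  (phi (pid p), pkind p, prole p).

(** Covers both reordering of components ([sigma], [tau]) and renaming of crossings ([phi], [psi]);
    inverses are required only on the indices that occur. *)
Record relabel (D D' : diagram) (sigma tau phi psi : nat -> nat) : Prop :=
  Relabel {
  rl_comp : forall i, i < size D' ->
    [/\ sigma i < size D, tau (sigma i) = i &
        nth [::] D' i = map (rename phi) (nth [::] D (sigma i))];
  rl_id : {in flatten D, forall p, psi (phi (pid p)) = pid p}
}.

Definition relabel_agree (D D' : diagram) (sigma phi : nat -> nat)
    (Q : quandle) (f f' : coll Q) : Prop :=
  (forall i, i < size D' -> f'.1 i = f.1 (sigma i)) /\
  {in flatten D, forall p, f'.2 (rename phi p) = f.2 p}.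

Lemma relabel_mem D D' sigma tau phi psi p' : relabel D D' sigma tau phi psi ->
  p' \in flatten D' -> exists2 p, p \in flatten D & p' = rename phi p.
Proof.
move=> rl /mem_flatten_nthP[i li]; have [ls _ ->] := rl_comp rl li.
case/mapP=> p pD ->; exists p => //.
by apply/mem_flatten_nthP; exists (sigma i).
Qed.

Lemma relabel_transfer D D' sigma tau phi psi : relabel D D' sigma tau phi psi ->
  transfer D D' (@relabel_agree D D' sigma phi).
Proof.
move=> rl; have renK : {in flatten D, cancel (rename phi) (rename psi)}.
  by move=> p Dp; rewrite /rename (rl_id rl Dp); case: p {Dp} => [[]].
split.
- move=> Q f cf; exists (f.1 \o sigma, f.2 \o rename psi).
    split=> [i li|p' /(relabel_mem rl)[p Dp ->]|i j li lj].
    + have [ls _ ->] := rl_comp rl li; apply/walk_map.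
      apply: eq_in_walk (col_walk cf ls) => p Dp /=; rewrite renK //.
      by apply/mem_flatten_nthP; exists (sigma i).
    + have := col_ok cf Dp.
      by rewrite /passage_ok /rename /pid /pkind /= -/(pid _) (rl_id rl Dp).
    + have [ls _ _] := rl_comp rl li; have [ls' _ _] := rl_comp rl lj.
      exact: (col_triv cf).
  by split=> // p Dp; rewrite /= renK.
- move=> Q f f1 f2 _ _ _ [b1 p1] [b2 p2].
  split=> [i li|p' /(relabel_mem rl)[p Dp ->]]; first by rewrite b1 ?b2.
  by rewrite p1 ?p2.
- move=> Q Q' h f f' _ [b p]; split=> [i li|q Dq] /=; first by rewrite b.
  by rewrite p.
- move=> Q f g f' [fgb fgp] [b p]; split=> [i li|q Dq] /=.
    by have [ls _ _] := rl_comp rl li; rewrite b // fgb.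
  by rewrite p // fgp.
Qed.

Lemma relabel_agreeC D D' sigma tau phi psi (Q : quandle) (f f' : coll Q) :
  relabel D D' sigma tau phi psi -> relabel D' D tau sigma psi phi ->
  relabel_agree D D' sigma phi f f' -> relabel_agree D' D tau psi f' f.
Proof.
move=> rl rl' [b p]; split=> [j lj|q' /(relabel_mem rl)[q Dq ->]].
  by have [lt st _] := rl_comp rl' lj; rewrite b // st.
rewrite p //; congr f.2; rewrite /rename /= (rl_id rl Dq).
by case: q {Dq} => [[]].
Qed.

Lemma relabel_iso D D' sigma tau phi psi :
  wf_diagram D -> wf_diagram D' -> 0 < size D -> 0 < size D' ->
  relabel D D' sigma tau phi psi -> relabel D' D tau sigma psi phi ->
  quandle_iso (Qtilde D) (Qtilde D').
Proof.
move=> wfD wfD' sD sD' rl rl'.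
apply: (transfer_iso wfD wfD' sD sD' (relabel_transfer rl)).
apply: eq_transfer (relabel_transfer rl') => Q f f'.
by split; apply: relabel_agreeC.
Qed.

Lemma perm_iso D D' : wf_diagram D -> wf_diagram D' -> 0 < size D ->
  perm_eq D D' -> quandle_iso (Qtilde D) (Qtilde D').
Proof.
move=> wfD wfD' sD pDD'; have eqs := perm_size pDD'.
have sD' : 0 < size D' by rewrite -eqs.
(* [Is] lists, for each component of [D], its place in [D']; [index] and [nth] in this list give the
   two relabellings of components. *)
have [Is pI eD] := (perm_iotaP [::] pDD'); rewrite -eqs in pI.
have sI : size Is = size D by rewrite (perm_size pI) size_iota.
have uI : uniq Is by rewrite (perm_uniq pI) iota_uniq.
have memI j : (j \in Is) = (j < size D).
  by rewrite (perm_mem pI) mem_iota.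
have renid l : map (rename id) l = l.
  by rewrite -[RHS]map_id; apply: eq_map => -[[]].
have nthD i : i < size D -> nth [::] D i = nth [::] D' (nth 0 Is i).
  by move=> li; rewrite eD (nth_map 0) // sI.
apply: (@relabel_iso _ _ (index^~ Is) (nth 0 Is) id id) => //; split=> // i li.
- rewrite -eqs -memI in li; rewrite -{1}sI index_mem nth_index // renid nthD ?nth_index //.
  by rewrite -sI index_mem.
- by rewrite -eqs -memI mem_nth ?sI // index_uniq ?sI // renid nthD.
Qed.

Lemma rename_iso D D' phi : wf_diagram D -> wf_diagram D' -> 0 < size D ->
  injective phi -> D' = map (map (rename phi)) D ->
  quandle_iso (Qtilde D) (Qtilde D').
Proof.
move=> wfD wfD' sD phiI eD'.
pose ids := map pid (flatten D).
(* [phi] is merely injective; its inverse is obtained by lookup among the crossing names that occur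
   in [D]. *)
pose psi y := nth 0 ids (index y (map phi ids)).
have psiK : {in flatten D, forall p, psi (phi (pid p)) = pid p}.
  by move=> p Dp; rewrite /psi nth_index_map ?map_f // => x y _ _ /phiI.
have memD i : i < size D -> {subset nth [::] D i <= flatten D}.
  by move=> li p pD; apply/mem_flatten_nthP; exists i.
apply: (@relabel_iso _ _ id id phi psi) => //; rewrite eD' ?size_map //; split.
- by move=> i; rewrite size_map => li; rewrite (nth_map [::]).
- exact: psiK.
- move=> i li; rewrite size_map (nth_map [::]) // -map_comp; split=> //.
  rewrite -[LHS]map_id; apply/eq_in_map => p /(memD _ li) Dp.
  by rewrite /rename /= psiK //; case: p {Dp} => [[]].
- move=> p; rewrite -map_flatten => /mapP[q Dq ->].
  by rewrite /rename /= psiK.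
Qed.

(** Moving a base point may change its state, so base points are compared only on components without
    passages. *)
Definition rot_agree (D : diagram) (Q : quandle) (f f' : coll Q) : Prop :=
  (forall i, i < size D -> nth [::] D i = [::] -> f.1 i = f'.1 i) /\
  {in flatten D, f.2 =1 f'.2}.

Definition rot_comp (D : diagram) c k := set_nth [::] D c (rot k (nth [::] D c)).

Lemma size_rot_comp D c k : c < size D -> size (rot_comp D c k) = size D.
Proof. by move=> lc; rewrite size_set_nth; apply/maxn_idPr. Qed.

Lemma nth_rot_comp D c k i :
  nth [::] (rot_comp D c k) i = if i == c then rot k (nth [::] D c) else nth [::] D i.
Proof. by rewrite nth_set_nth. Qed.

Lemma mem_rot_comp D c k : c < size D -> flatten (rot_comp D c k) =i flatten D.
Proof.
move=> lc p; have H i : (p \in nth [::] (rot_comp D c k) i) = (p \in nth [::] D i).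
  by rewrite nth_rot_comp; case: eqP => // ->; rewrite mem_rot.
apply/mem_flatten_nthP/mem_flatten_nthP => -[i].
  by rewrite size_rot_comp // H; exists i.
by move=> li pi; exists i; rewrite ?size_rot_comp // H.
Qed.

Lemma nil_rot_comp D c k i :
  (nth [::] (rot_comp D c k) i == [::]) = (nth [::] D i == [::]).
Proof.
by rewrite nth_rot_comp; case: (i =P c) => // ->; rewrite -!size_eq0 size_rot.
Qed.

Lemma rot_transfer D c k : c < size D ->
  transfer D (rot_comp D c k) (@rot_agree D).
Proof.
move=> lc; split.
- move=> Q f cf; have := col_walk cf lc.
  (* The new base point state [m] is the one reached after the first [k] passages; it has the same
     y-label as the old one. *)
  rewrite -{1}(cat_take_drop k (nth [::] D c)) => /walk_cat[m [w1 w2]].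
  have ym : m.2 = (f.1 c).2.
    apply: walk_y w1 => p /mem_take pc; apply/passage_ok_y/(col_ok cf).
    by apply/mem_flatten_nthP; exists c.
  have yE i : (if i == c then m else f.1 i).2 = (f.1 i).2 by case: eqP => // ->.
  exists (fun i => if i == c then m else f.1 i, f.2).
    split=> [i|p|i j]; rewrite ?size_rot_comp //=.
    + move=> li; rewrite nth_rot_comp; case: eqP => _; last exact: (col_walk cf).
      by apply/walk_cat; exists (f.1 c).
    + by rewrite mem_rot_comp //; exact: (col_ok cf).
    + by move=> li lj; rewrite !yE (col_triv cf).
  split=> //= i _ ni; case: eqP => // ic; rewrite ic in ni *.
  by move: w1; rewrite ni.
- move=> Q f f1 f2 _ c1 c2 [b1 p1] [b2 p2].
  have ep : {in flatten (rot_comp D c k), f1.2 =1 f2.2}.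
    by move=> p; rewrite mem_rot_comp // => Dp; rewrite -p1 ?p2.
  (* On a component with passages, the base point state is the outgoing state of the last
     passage. *)
  split=> // i li; have /(walkP _ dpass)[_ ->] := col_walk c1 li.
  have /(walkP _ dpass)[_ ->] := col_walk c2 li.
  case E: (size _) => [|n]; last by rewrite ep // mem_comp_flatten ?E.
  rewrite size_rot_comp // in li; rewrite -b1 ?b2 //; apply/eqP;
    by rewrite -(nil_rot_comp D c k) -size_eq0 E.
- by move=> Q Q' h f f' _ [b p]; split=> [i li ni|q Dq] /=; rewrite ?b ?p.
- by move=> Q f g f' [fgb fgp] [b p]; split=> [i li ni|q Dq]; rewrite -?fgb -?fgp ?b ?p.
Qed.

Lemma rot_iso D c k : wf_diagram D -> wf_diagram (rot_comp D c k) -> c < size D ->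
  quandle_iso (Qtilde D) (Qtilde (rot_comp D c k)).
Proof.
move=> wfD wfD' lc; have sD : 0 < size D by apply: leq_trans lc.
have sD' : 0 < size (rot_comp D c k) by rewrite size_rot_comp.
apply: (transfer_iso wfD wfD' sD sD' (rot_transfer k lc)).
(* Rotating by the complement of [k] undoes the rotation, so the converse transfer is again a
   rotation. *)
pose k' := size (rot k (nth [::] D c)) - k.
have eD : D = rot_comp (rot_comp D c k) c k'.
  apply: (@eq_from_nth _ [::]) => [|i _]; first by rewrite !size_rot_comp.
  rewrite !nth_rot_comp eqxx; case: eqP => [->|//].
  by rewrite -/(rotr k _) rotK.
rewrite {2}eD; apply: eq_transfer (@rot_transfer _ c k' _); last by rewrite size_rot_comp.
move=> Q f f'; split=> -[b p]; split.
- by move=> i li /eqP ni; rewrite b ?size_rot_comp //; apply/eqP; rewrite nil_rot_comp.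
- by move=> q Dq; rewrite p // mem_rot_comp.
- by move=> i; rewrite size_rot_comp // => li /eqP; rewrite nil_rot_comp => /eqP ni; rewrite b.
- by move=> q; rewrite mem_rot_comp // => Dq; rewrite p.
Qed.

(** * Templates *)

Definition fill_line (B : nat -> seq passage) (l : seq (passage + nat)) :=
  flatten (map (fun e => match e with inl p => [:: p] | inr h => B h end) l).

(** Treats a hole as a single passage with entry and exit states [hs h], so that a template line can
    itself be walked. *)
Definition track (Q : quandle) (st : passage -> pstate Q)
    (hs : nat -> pstate Q) (e : passage + nat) : pstate Q :=
  match e with inl p => st p | inr h => hs h end.

Lemma fill_nth T B i : nth [::] (fill T B) i = fill_line B (nth [::] T i).
Proof.
case: (ltnP i (size T)) => li; first by rewrite (nth_map [::]).
by rewrite !nth_default ?size_map.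
Qed.

Lemma fill_line_walk (Q : quandle) B (st st' : passage -> pstate Q) hs s s' l :
  (forall p, inl p \in l -> st' p = st p) ->
  (forall h, inr h \in l -> walk st' (hs h).1 (hs h).2 (B h)) ->
  walk (track st hs) s s' l -> walk st' s s' (fill_line B l).
Proof.
elim: l s => [|e l IH] s //= stE wB [es w].
have {}IH := IH _ _ _ w.
have {}IH : walk st' (track st hs e).2 s' (fill_line B l).
  by apply: IH => [p lp|h lh]; [apply: stE | apply: wB]; rewrite inE ?lp ?lh orbT.
case: e es stE wB {w} IH => [p|h] /= <- stE wB w.
  by rewrite stE ?mem_head.
by apply/walk_cat; exists (hs h).2; split=> //; apply: wB; rewrite mem_head.
Qed.

(** Cuts a walk at the borders of the holes. A hole must occur at most once since [hs] gives it one
    pair of states; [hs0] prescribes the holes of other lines, so that lines can be combined. *)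
Lemma fill_line_holes (Q : quandle) B (st : passage -> pstate Q) hs0 s s' l :
  (forall h, count_mem (inr h) l <= 1) -> walk st s s' (fill_line B l) ->
  exists hs, [/\ forall h, inr h \notin l -> hs h = hs0 h,
    walk (track st hs) s s' l &
    forall h, inr h \in l -> walk st (hs h).1 (hs h).2 (B h)].
Proof.
elim: l s => [|e l IH] s cnt w; first by exists hs0.
have cnt' h : count_mem (inr h) l <= 1.
  by apply: leq_trans (cnt h) => /=; apply: leq_addl.
case: e cnt w => [p|h] cnt.
  move=> [ps /(IH _ cnt')[hs [hsE wl wB]]]; exists hs; split=> [h||h].
  - by rewrite in_cons negb_or => /andP[_]; apply: hsE.
  - by [].
  - by rewrite in_cons => /predU1P[//|]; apply: wB.
case/walk_cat=> m [wh /(IH _ cnt')[hs [hsE wl wB]]].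
have nlh : inr h \notin l.
  by rewrite -has_pred1 has_count -leqNgt; have := cnt h; rewrite /= eqxx add1n ltnS.
exists (fun h' => if h' == h then (s, m) else hs h'); split=> [h'||h'].
- rewrite inE negb_or => /andP[neq /hsE]; case: eqP => // eqh.
  by rewrite eqh eqxx in neq.
- rewrite /= eqxx; split=> //; apply: eq_in_walk wl => -[//|h'] /= lh'.
  by case: eqP => // eqh; rewrite -eqh lh' in nlh.
- rewrite inE; case: (h' =P h) => [-> _ //|neq] /predU1P[[//]|].
  exact: wB.
Qed.

Lemma fill_holes (Q : quandle) B (st : passage -> pstate Q) hs0
    (b : nat -> state Q) (T : template) :
  (forall h, count_mem (inr h) (flatten T) <= 1) ->
  (forall i, i < size T -> walk st (b i) (b i) (fill_line B (nth [::] T i))) ->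
  exists hs, [/\ forall h, inr h \notin flatten T -> hs h = hs0 h,
    forall i, i < size T -> walk (track st hs) (b i) (b i) (nth [::] T i) &
    forall h, inr h \in flatten T -> walk st (hs h).1 (hs h).2 (B h)].
Proof.
elim: T b => [|l T IH] b cnt w; first by exists hs0.
have cnt1 h : count_mem (inr h) l <= 1.
  by apply: leq_trans (cnt h); rewrite /= count_cat leq_addr.
have cnt2 h : count_mem (inr h) (flatten T) <= 1.
  by apply: leq_trans (cnt h); rewrite /= count_cat leq_addl.
have disj h : inr h \in flatten T -> inr h \notin l.
  rewrite -!has_pred1 !has_count -leqNgt; have := cnt h; rewrite /= count_cat.
  by move=> le lt; rewrite -(leq_add2r (count_mem (inr h) (flatten T))) (leq_trans le).
have [hs1 [E1 w1 B1]] := IH (b \o S) cnt2 (fun i => w i.+1).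
(* Taking [hs1] as default keeps the states already found for the holes of the other lines. *)
have [hs2 [E2 w2 B2]] := fill_line_holes hs1 cnt1 (w 0 isT).
exists hs2; split=> [h|[|i]|h] /=.
- by rewrite mem_cat negb_or => /andP[/E2-> /E1].
- by [].
- rewrite ltnS => li; apply: eq_in_walk (w1 i li) => -[//|h] /= lh.
  by rewrite E2 // disj //; apply/mem_flatten_nthP; exists i.
- rewrite mem_cat; case: (boolP (inr h \in l)) => [/B2 //|/E2 -> /= lh].
  exact: B1.
Qed.

Lemma mem_fill T B p : reflect
  (inl p \in flatten T \/ exists2 h, inr h \in flatten T & p \in B h)
  (p \in flatten (fill T B)).
Proof.
apply: (iffP (mem_flatten_nthP _ _)) => [[i]|].
  rewrite size_map fill_nth => li /flatten_mapP[e le pe].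
  have Te : e \in flatten T by apply/mem_flatten_nthP; exists i.
  by case: e {le} Te pe => [q|h] Te; [rewrite inE => /eqP ->; left | right; exists h].
have fillm e : e \in flatten T ->
    p \in (match e with inl p => [:: p] | inr h => B h end) ->
    exists2 i, i < size (fill T B) & p \in nth [::] (fill T B) i.
  case/mem_flatten_nthP=> i li le pe; exists i; rewrite ?size_map // fill_nth.
  by apply/flatten_mapP; exists e.
case=> [Tp|[h Th ph]]; last exact: (fillm (inr h)).
by apply: (fillm (inl p)); rewrite ?mem_head.
Qed.

Lemma template_hole m T h : template_ok m T -> (inr h \in flatten T) = (h < m).
Proof. by move=> okT; rewrite -has_pred1 has_count okT lt0b. Qed.

Definition block_col (Q : quandle) m (B : nat -> seq passage)
    (hs : nat -> pstate Q) (st : passage -> pstate Q) : Prop :=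
  forall h, h < m ->
    walk st (hs h).1 (hs h).2 (B h) /\ {in B h, forall p, passage_ok st p}.

(** Local form of [transfer] with fixed states at the ends of the strands; triviality of the
    entering y-labels is what the global colouring supplies. *)
Record local_transfer (m : nat) (B B' : nat -> seq passage) : Prop :=
  LocalTransfer {
  lt_exists : forall (Q : quandle) (hs : nat -> pstate Q) st,
    (forall h h', h < m -> h' < m -> qop (hs h).1.2 (hs h').1.2 = (hs h).1.2) ->
    block_col m B hs st -> exists st', block_col m B' hs st';
  lt_unique : forall (Q : quandle) (hs : nat -> pstate Q) st st',
    block_col m B' hs st -> block_col m B' hs st' ->
    forall h, h < m -> {in B' h, st =1 st'}
}.

Section Template.
Variables (m : nat) (T : template) (ids : seq nat).
Hypotheses (okT : template_ok m T) (freshT : template_fresh T ids).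

(** Agreement outside the holes, together with common entry and exit states [hs] for both fillings
    of each hole. *)
Definition fill_agree (B B' : nat -> seq passage) (Q : quandle) (f f' : coll Q) :=
  [/\ forall i, i < size T -> f.1 i = f'.1 i,
      forall p, inl p \in flatten T -> f.2 p = f'.2 p &
      exists2 hs : nat -> pstate Q,
        forall i, i < size T -> walk (track f.2 hs) (f.1 i) (f.1 i) (nth [::] T i) &
        forall h, h < m -> walk f.2 (hs h).1 (hs h).2 (B h) /\
                           walk f'.2 (hs h).1 (hs h).2 (B' h)].

Lemma fill_agreeC B B' (Q : quandle) (f f' : coll Q) :
  fill_agree B B' f f' -> fill_agree B' B f' f.
Proof.
case=> eb ep [hs w wB]; split=> [i li|p Tp|]; rewrite ?eb ?ep //.
exists hs => [i li|h /wB[]//]; rewrite -eb //.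
apply: eq_in_walk (w i li) => -[p|//] Tp /=; apply: ep.
by apply/mem_flatten_nthP; exists i.
Qed.

(** The y-label does not change between the base point and the hole, so triviality at base points
    passes to hole entries. *)
Lemma hole_y B (Q : quandle) (f : coll Q) (hs : nat -> pstate Q) h :
  coloring (fill T B) f ->
  (forall i, i < size T -> walk (track f.2 hs) (f.1 i) (f.1 i) (nth [::] T i)) ->
  (forall h, h < m -> walk f.2 (hs h).1 (hs h).2 (B h)) ->
  h < m -> exists2 i, i < size T & (hs h).1.2 = (f.1 i).2.
Proof.
move=> cf w wB; rewrite -(template_hole h okT) => /mem_flatten_nthP[i li Ti].
exists i => //; move: (w i li).
have sub : {subset nth [::] T i <= flatten T}.
  by move=> e Te; apply/mem_flatten_nthP; exists i.
case/splitPr: Ti sub => l1 l2 sub /walk_cat[s [w1 [/= -> _]]].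
apply: walk_y w1 => e l1e; have {}l1e : e \in flatten T.
  by apply: sub; rewrite mem_cat l1e.
case: e l1e => [p|h'] /= Te.
  by apply/passage_ok_y/(col_ok cf)/mem_fill; left.
apply: walk_y (wB h' _); last by rewrite -(template_hole _ okT).
by move=> p Bp; apply/passage_ok_y/(col_ok cf)/mem_fill; right; exists h'.
Qed.

Lemma fill_transfer B B' :
  (forall h, h < m -> {in B' h, forall p, pid p \in ids}) ->
  local_transfer m B B' -> transfer (fill T B) (fill T B') (@fill_agree B B').
Proof.
move=> idB' lt; have cnt h : count_mem (inr h) (flatten T) <= 1.
  by rewrite okT; case: (_ < _).
have fresh p : inl p \in flatten T -> pid p \notin ids by move/freshT.
split.
- move=> Q f cf.
  have wf i : i < size T -> walk f.2 (f.1 i) (f.1 i) (fill_line B (nth [::] T i)).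
    by move=> li; rewrite -fill_nth; apply: (col_walk cf); rewrite size_map.
  have [hs [_ w wB]] := fill_holes (fun _ => (f.1 0, f.1 0)) cnt wf.
  have {}wB h : h < m -> walk f.2 (hs h).1 (hs h).2 (B h).
    by rewrite -(template_hole h okT) => /wB.
  have [||st' col'] := @lt_exists _ _ _ lt Q hs f.2.
  + move=> h h' /(hole_y cf w wB)[i li ->] /(hole_y cf w wB)[j lj ->].
    by apply: (col_triv cf); rewrite size_map.
  + move=> h lh; split; first exact: wB.
    move=> p Bp; apply/(col_ok cf)/mem_fill; right; exists h => //.
    by rewrite (template_hole h okT).
  (* Gluing: crossings of the move are coloured by [st'], all others as before. Freshness of [ids]
     prevents any conflict. *)
  pose g p := if pid p \in ids then st' p else f.2 p.
  have gB h : h < m -> walk g (hs h).1 (hs h).2 (B' h).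
    move=> lh; apply: eq_in_walk (col' h lh).1 => p Bp.
    by rewrite /g (idB' h lh p Bp).
  have gT p : inl p \in flatten T -> g p = f.2 p.
    by rewrite /g => /fresh /negPf ->.
  exists (f.1, g); last first.
    by split=> //= [p Tp|]; [rewrite gT | exists hs => // h lh; split; auto].
  split=> [i|p /mem_fill|i j] /=; rewrite ?size_map.
  + move=> li; rewrite fill_nth; apply: fill_line_walk (w i li) => [p Tp|h Th].
      by apply: gT; apply/mem_flatten_nthP; exists i.
    apply: gB; rewrite -(template_hole h okT).
    by apply/mem_flatten_nthP; exists i.
  + case=> [Tp|[h]].
      apply: (eq_passage_ok (st := f.2)) => [r|]; last first.
        by apply/(col_ok cf)/mem_fill; left.
      by rewrite /g (negPf (fresh p Tp)).
    rewrite (template_hole h okT) => lh Bp.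
    apply: eq_passage_ok ((col' h lh).2 p Bp) => r.
    by rewrite /g (idB' h lh p Bp).
  + by move=> li lj; apply: (col_triv cf); rewrite size_map.
- move=> Q f f1 f2 cf c1 c2 [b1 p1 [hs1 w1 B1]] [b2 p2 [hs2 w2 B2]].
  (* Both families come from the same [f], whose walk through [B h] determines the exit from the
     entry. *)
  have hsE h : h < m -> hs1 h = hs2 h.
    rewrite -(template_hole h okT) => /mem_flatten_nthP[i li Th].
    apply: (walk_unique _ (w1 i li) (w2 i li) Th) => -[//|h'] /= Th'.
    have lh' : h' < m.
      by rewrite -(template_hole h' okT); apply/mem_flatten_nthP; exists i.
    have [wa _] := B1 h' lh'; have [wb _] := B2 h' lh'; move: wa wb.
    case: (hs1 h') (hs2 h') => [s s1] [s' s2] /= wa wb es; subst s'.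
    by rewrite (walk_functional wa wb).
  split=> [i|p Dp]; rewrite ?size_map; first by move=> li; rewrite -b1 // b2.
  have col g : coloring (fill T B') g -> (forall h, h < m ->
      walk g.2 (hs1 h).1 (hs1 h).2 (B' h)) -> block_col m B' hs1 g.2.
    move=> cg wg h lh; split=> [|q Bq]; first exact: wg.
    apply/(col_ok cg)/mem_fill; right; exists h => //.
    by rewrite (template_hole h okT).
  case/mem_fill: Dp => [Tp|[h]]; first by rewrite -p1 ?p2.
  rewrite (template_hole h okT) => lh Bp.
  apply: (lt_unique lt (col _ c1 _) (col _ c2 _) lh Bp) => h' lh'.
    by case: (B1 h' lh').
  by rewrite hsE //; case: (B2 h' lh').
- move=> Q Q' k f f' _ [eb ep [hs w wB]]; split=> [i li|p Tp|] /=; rewrite ?eb ?ep //.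
  exists (psmap k \o hs) => [i li|h lh].
    apply: eq_in_walk (hom_walk k (w i li)).
    by move=> [p|h].
  by have [w1 w2] := wB h lh; split; apply: hom_walk.
- move=> Q f g f' [fgb fgp] [eb ep [hs w wB]].
  rewrite size_map in fgb; split=> [i li|p Tp|].
  + by rewrite -fgb ?eb.
  + by rewrite -fgp ?ep //; apply/mem_fill; left.
  exists hs => [i li|h lh].
    rewrite -fgb //; apply: eq_in_walk (w i li) => -[p|//] Tp; apply: fgp.
    by apply/mem_fill; left; apply/mem_flatten_nthP; exists i.
  have [w1 w2] := wB h lh; split=> //; apply: eq_in_walk w1 => p Bp; apply: fgp.
  by apply/mem_fill; right; exists h; rewrite ?(template_hole h okT).
Qed.

End Template.

Lemma fill_iso m T ids B B' : wf_diagram (fill T B) -> wf_diagram (fill T B') ->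
  0 < size T -> template_ok m T -> template_fresh T ids ->
  (forall h, h < m -> {in B h, forall p, pid p \in ids}) ->
  (forall h, h < m -> {in B' h, forall p, pid p \in ids}) ->
  local_transfer m B B' -> local_transfer m B' B ->
  quandle_iso (Qtilde (fill T B)) (Qtilde (fill T B')).
Proof.
move=> wfD wfD' sT okT fT idB idB' lt lt'.
have tr := fill_transfer okT fT idB' lt.
have tr' := fill_transfer okT fT idB lt'.
apply: (transfer_iso wfD wfD' _ _ tr); rewrite ?size_map //.
by apply: eq_transfer tr' => Q f f'; split; apply: fill_agreeC.
Qed.

(** * Generalized Reidemeister moves *)

Lemma passage_okE (Q : quandle) (st : passage -> pstate Q) x k r0 r :
  passage_ok st (mkp x k r0) =
  crossing_ok_at k r (st (mkp x k r)) (st (mkp x k (~~ r))).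
Proof. by case: r. Qed.

Lemma strandP (Q : quandle) (st : passage -> pstate Q) (e : bool) U V i o :
  walk st i o (if e then [:: U; V] else [:: V; U]) <->
  exists m, st U = fst_edge e i m o /\ st V = snd_edge e i m o.
Proof.
have H W W' : walk st i o [:: W; W'] <-> exists m, st W = (i, m) /\ st W' = (m, o).
  rewrite /=; case: (st W) (st W') => [w1 w2] [w3 w4] /=.
  split=> [[-> [-> ->]]|[m [[-> ->] [-> ->]]]//]; by exists w2.
case: e; first exact: H.
by split=> [/H|] [m []]; [exists m | move=> ? ?; apply/H; exists m].
Qed.

Lemma strand_ok (Q : quandle) (st : passage -> pstate Q) (e : bool) U V :
  {in (if e then [:: U; V] else [:: V; U]), forall p, passage_ok st p} <->
  passage_ok st U /\ passage_ok st V.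
Proof.
split=> [ok|[okU okV] p].
  by split; apply: ok; case: e; rewrite !inE eqxx ?orbT.
by case: e; rewrite !inE => /orP[] /eqP ->.
Qed.

Lemma kink_col (Q : quandle) x k r (B : nat -> seq passage) hs
    (st : passage -> pstate Q) :
  B 0 = [:: mkp x k r; mkp x k (~~ r)] ->
  block_col 1 B hs st <->
  exists m, kink_ok k r (hs 0).1 m (hs 0).2 /\
    st (mkp x k r) = ((hs 0).1, m) /\ st (mkp x k (~~ r)) = (m, (hs 0).2).
Proof.
move=> B0; split=> [/(_ 0 isT)|[m [ok [s1 s2]]] [|//] _]; rewrite B0.
  case=> /(strandP st true)[m [s1 s2]] /(strand_ok st true)[ok _].
  by exists m; move: ok; rewrite (passage_okE _ _ _ _ r) s1 s2.
split; first by apply/(strandP st true); exists m.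
by apply/(strand_ok st true); rewrite !(passage_okE _ _ _ _ r) s1 s2.
Qed.

Lemma nil_col (Q : quandle) m (B : nat -> seq passage) hs (st : passage -> pstate Q) :
  (forall h, h < m -> B h = [::]) ->
  block_col m B hs st <-> forall h, h < m -> (hs h).1 = (hs h).2.
Proof.
by move=> B0; split=> H h lh; have := H h lh; rewrite B0 // => -[].
Qed.

Lemma move1_transfer B B' ids : move1 B B' ids ->
  local_transfer 1 B B' /\ local_transfer 1 B' B.
Proof.
case=> x [k [r [_ [B0 B1]]]].
have Bnil h : h < 1 -> B h = [::] by case: h.
split; split=> Q hs st.
- move=> _ /(nil_col _ _ Bnil)/(_ 0 isT) hs0.
  have [m ok] := kink_exists k r (hs 0).1.
  (* The two passages of the kink belong to the same crossing and are told apart by their roles. *)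
  exists (fun p => if prole p == r then ((hs 0).1, m) else (m, (hs 0).2)).
  apply/(kink_col _ _ B1); exists m; rewrite -hs0 /= eqxx; split=> //; split=> //.
  by case: r {B1 ok}.
- move=> st' /(kink_col _ _ B1)[m [ok [s1 s2]]].
  move=> /(kink_col _ _ B1)[m' [ok' [s1' s2']]] [|//] _ p.
  have [_ mE] := kink_unique ok; have [_ mE'] := kink_unique ok'.
  by rewrite B1 !inE => /orP[] /eqP ->; rewrite ?s1 ?s1' ?s2 ?s2' mE mE'.
- move=> _ /(kink_col _ _ B1)[m [ok _]]; exists st; apply/(nil_col _ _ Bnil) => -[|//] _.
  by case: (kink_unique ok).
- by move=> st' _ _ h /Bnil ->.
Qed.

Lemma bigon_col (Q : quandle) x y k k' r par (B : nat -> seq passage) hs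
    (st : passage -> pstate Q) :
  B 0 = [:: mkp x k r; mkp y k' (~~ r)] ->
  B 1 = (if par then [:: mkp x k (~~ r); mkp y k' r]
         else [:: mkp y k' r; mkp x k (~~ r)]) ->
  block_col 2 B hs st <->
  exists m0 m1, bigon_ok par k k' r (hs 0).1 m0 (hs 0).2 (hs 1).1 m1 (hs 1).2 /\
    [/\ st (mkp x k r) = ((hs 0).1, m0), st (mkp y k' (~~ r)) = (m0, (hs 0).2),
        st (mkp x k (~~ r)) = fst_edge par (hs 1).1 m1 (hs 1).2 &
        st (mkp y k' r) = snd_edge par (hs 1).1 m1 (hs 1).2].
Proof.
move=> B0 B1; split=> [col|[m0 [m1 [[okx oky] [s1 s2 s3 s4]]]]].
  have := col 0 isT; have := col 1 isT; rewrite B0 B1.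
  case=> /strandP[m1 [s3 s4]] _ [/(strandP st true)[m0 [s1 s2]]].
  move=> /(strand_ok st true)[okx oky]; exists m0, m1; split=> //.
  move: okx oky; rewrite (passage_okE _ _ _ _ r) (passage_okE _ _ _ _ (~~ r)).
  by rewrite negbK s1 s2 s3 s4.
have ok : passage_ok st (mkp x k r) /\ passage_ok st (mkp y k' r).
  by rewrite (passage_okE _ x _ _ r) (passage_okE _ y _ _ (~~ r)) negbK s1 s2 s3 s4.
move=> [|[|//]] _; rewrite ?B0 ?B1; split.
- by apply/(strandP st true); exists m0.
- exact/(strand_ok st true).
- by apply/strandP; exists m1.
- exact/strand_ok.
Qed.

Lemma move2_transfer B B' ids : move2 B B' ids ->
  local_transfer 2 B B' /\ local_transfer 2 B' B.
Proof.
case=> x [y [k [k' [r [[_ neqxy] kk' [B0 B1] B0' B1']]]]].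
have {B1'}[par B1'] : exists par : bool, B' 1 =
    if par then [:: mkp x k (~~ r); mkp y k' r] else [:: mkp y k' r; mkp x k (~~ r)].
  by case: B1' => ->; [exists true | exists false].
have Bnil h : h < 2 -> B h = [::] by case: h => [|[|]].
split; split=> Q hs st.
- move=> _ /(nil_col _ _ Bnil) hsE.
  have [m0 [m1 ok]] := bigon_exists par r (hs 0).1 (hs 1).1 kk'.
  exists (fun p => if pid p == x
    then if prole p == r then ((hs 0).1, m0) else fst_edge par (hs 1).1 m1 (hs 1).2
    else if prole p == r then snd_edge par (hs 1).1 m1 (hs 1).2 else (m0, (hs 0).2)).
  apply/(bigon_col _ _ B0' B1'); exists m0, m1; rewrite -!hsE //.
  rewrite /mkp /pid /prole /= eqxx [y == x]eq_sym (negPf neqxy) eqxx.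
  by case: r {B0' B1'} ok.
- move=> st' /(bigon_col _ _ B0' B1')[m0 [m1 [ok [s1 s2 s3 s4]]]].
  move=> /(bigon_col _ _ B0' B1')[m0' [m1' [ok' [s1' s2' s3' s4']]]].
  have [_ _ /(_ ok')[e0 e1]] := bigon_unique m0' m1' kk' ok; subst m0' m1'.
  move=> [|[|//]] _ p; rewrite ?B0' ?B1'; last case: par {B1' ok ok'} s3 s4 s3' s4' => s3 s4 s3' s4';
    by rewrite !inE => /orP[] /eqP ->; congruence.
- move=> _ /(bigon_col _ _ B0' B1')[m0 [m1 [ok _]]]; exists st.
  have [e0 e1 _] := bigon_unique m0 m1 kk' ok.
  by apply/(nil_col _ _ Bnil) => -[|[|]].
- by move=> st' _ _ h /Bnil ->.
Qed.

Section Triangle.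
Variables (xP xQ xR : nat) (kP kQ kR : ckind) (raQ rbR rcP : bool).

(** Roles are parameters separate from the directions, so the block after the move is the same one
    with all three directions negated. *)
Definition triangle_block (ea eb ec : bool) (h : nat) : seq passage :=
  let Pa := mkp xP kP (~~ rcP) in let Pc := mkp xP kP rcP in
  let Qa := mkp xQ kQ raQ in let Qb := mkp xQ kQ (~~ raQ) in
  let Rb := mkp xR kR rbR in let Rc := mkp xR kR (~~ rbR) in
  match h with
  | 0 => if ea then [:: Pa; Qa] else [:: Qa; Pa]
  | 1 => if eb then [:: Qb; Rb] else [:: Rb; Qb]
  | _ => if ec then [:: Rc; Pc] else [:: Pc; Rc]
  end.

Lemma triangle_col (Q : quandle) ea eb ec (B : nat -> seq passage) hs
    (st : passage -> pstate Q) :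
  (forall h, h < 3 -> B h = triangle_block ea eb ec h) ->
  block_col 3 B hs st <->
  exists ma mb mc,
   [/\ triangle_ok kP kQ kR raQ rbR rcP ea eb ec (hs 0).1 ma (hs 0).2
         (hs 1).1 mb (hs 1).2 (hs 2).1 mc (hs 2).2,
       st (mkp xP kP (~~ rcP)) = fst_edge ea (hs 0).1 ma (hs 0).2 /\
       st (mkp xQ kQ raQ) = snd_edge ea (hs 0).1 ma (hs 0).2,
       st (mkp xQ kQ (~~ raQ)) = fst_edge eb (hs 1).1 mb (hs 1).2 /\
       st (mkp xR kR rbR) = snd_edge eb (hs 1).1 mb (hs 1).2 &
       st (mkp xR kR (~~ rbR)) = fst_edge ec (hs 2).1 mc (hs 2).2 /\
       st (mkp xP kP rcP) = snd_edge ec (hs 2).1 mc (hs 2).2].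
Proof.
move=> BE; split=> [col|[ma [mb [mc [[oQ oR oP] sa sb sc]]]]].
  have := col 0 isT; have := col 1 isT; have := col 2 isT; rewrite !BE //.
  case=> /strandP[mc sc] /strand_ok[_ okP] [/strandP[mb sb] /strand_ok[_ okR]].
  case=> /strandP[ma sa] /strand_ok[_ okQ]; exists ma, mb, mc; split=> //.
  case: sa sb sc => sPa sQa [sQb sRb] [sRc sPc].
  move: okP okQ okR; rewrite (passage_okE _ _ _ _ rcP) (passage_okE _ _ _ _ raQ).
  by rewrite (passage_okE _ _ _ _ rbR) sPa sQa sQb sRb sRc sPc.
have okP r : passage_ok st (mkp xP kP r).
  by rewrite (passage_okE _ _ _ _ rcP) sa.1 sc.2.
have okQ r : passage_ok st (mkp xQ kQ r).
  by rewrite (passage_okE _ _ _ _ raQ) sa.2 sb.1.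
have okR r : passage_ok st (mkp xR kR r).
  by rewrite (passage_okE _ _ _ _ rbR) sb.2 sc.1.
move=> h lh; rewrite BE //; case: h lh => [|[|[|//]]] _; split;
  by [apply/strandP; eexists; eassumption | apply/strand_ok].
Qed.

End Triangle.

Lemma triangle_transfer xP xQ xR kP kQ kR (ea eb ec : bool) B B' :
  uniq [:: xP; xQ; xR] ->
  r3_kinds kP kQ kR (ea != eb) (eb != ec) (ec != ea) ->
  (forall h, h < 3 -> B h =
    triangle_block xP xQ xR kP kQ kR (ea != eb) (eb != ec) (ec != ea) ea eb ec h) ->
  (forall h, h < 3 -> B' h =
    triangle_block xP xQ xR kP kQ kR (ea != eb) (eb != ec) (ec != ea)
      (~~ ea) (~~ eb) (~~ ec) h) ->
  local_transfer 3 B B'.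
Proof.
move=> uid kk BE BE'; split=> Q hs st.
- move=> triv /(triangle_col _ _ BE)[ma [mb [mc [ok _ _ _]]]].
  have [||ma' [mb' [mc' ok']]] := triangle_flip kk _ _ ok; [by split; apply: triv.. |].
  exists (fun p => if pid p == xP
    then if prole p == (ec != ea) then snd_edge (~~ ec) (hs 2).1 mc' (hs 2).2
         else fst_edge (~~ ea) (hs 0).1 ma' (hs 0).2
    else if pid p == xQ
    then if prole p == (ea != eb) then snd_edge (~~ ea) (hs 0).1 ma' (hs 0).2
         else fst_edge (~~ eb) (hs 1).1 mb' (hs 1).2
    else if prole p == (eb != ec) then snd_edge (~~ eb) (hs 1).1 mb' (hs 1).2
         else fst_edge (~~ ec) (hs 2).1 mc' (hs 2).2).
  move: uid; rewrite /= !inE negb_or andbT => /andP[/andP[PQ PR] QR].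
  have negb_eq b : (~~ b == b) = false by case: b.
  apply/(triangle_col _ _ BE'); exists ma', mb', mc'; split=> //;
    rewrite /mkp /pid /prole /= ?eqxx ?[xQ == _]eq_sym ?[xR == _]eq_sym;
    by rewrite ?(negPf PQ) ?(negPf PR) ?(negPf QR) ?eqxx ?negb_eq.
- move=> st' /(triangle_col _ _ BE')[ma [mb [mc [ok sa sb sc]]]].
  move=> /(triangle_col _ _ BE')[ma' [mb' [mc' [ok' sa' sb' sc']]]].
  (* Negating all directions preserves the roles, so [triangle_unique] applies to the flipped
     triangle. *)
  have neqN (u v : bool) : (u != v) = (~~ u != ~~ v) by case: u v => [] [].
  rewrite (neqN ea) (neqN eb) (neqN ec) in kk ok ok'.
  have [ea' eb' ec'] := triangle_unique kk ok ok'; subst ma' mb' mc'.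
  case: sa sb sc sa' sb' sc' => sPa sQa [sQb sRb] [sRc sPc] [tPa tQa] [tQb tRb] [tRc tPc].
  move=> h lh p; rewrite BE' //.
  case: h lh => [|[|[|//]]] _ /=; case: ifP => _; rewrite !inE => /orP[] /eqP ->;
    by congruence.
Qed.

Lemma move3_transfer B B' ids : move3 B B' ids ->
  local_transfer 3 B B' /\ local_transfer 3 B' B.
Proof.
case=> xP [xQ [xR [kP [kQ [kR [ea [eb [ec]]]]]]]] /=.
case=> [[-> uid] kk B0 [B1 B2] [B0' B1' B2']].
have BE h : h < 3 -> B h =
    triangle_block xP xQ xR kP kQ kR (ea != eb) (eb != ec) (ec != ea) ea eb ec h.
  by case: h => [|[|[|]]].
have BE' h : h < 3 -> B' h =
    triangle_block xP xQ xR kP kQ kR (ea != eb) (eb != ec) (ec != ea)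
      (~~ ea) (~~ eb) (~~ ec) h.
  case: h => [|[|[|//]]] _; rewrite ?B0' ?B1' ?B2' ?B0 ?B1 ?B2 /=;
  by [case: (ea) | case: (eb) | case: (ec)].
split; first exact: triangle_transfer BE BE'.
(* The reverse move is the same statement with negated directions. *)
have neqN (u v : bool) : (u != v) = (~~ u != ~~ v) by case: u v => [] [].
move: kk BE BE'; rewrite (neqN ea) (neqN eb) (neqN ec) => kk BE BE'.
by apply: triangle_transfer uid kk BE' _; rewrite !negbK.
Qed.

Lemma local_move_ids m B B' ids h p : local_move m B B' ids -> h < m ->
  (p \in B h) || (p \in B' h) -> pid p \in ids.
Proof.
case=> -[-> mv].
- case: mv => x [k [r [-> [B0 B1]]]]; case: h => // _; rewrite B0 B1 in_nil orFb.
  by rewrite !inE => /orP[] /eqP ->; rewrite eqxx.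
- case: mv => x [y [k [k' [r [[-> _] _ [B0 B1] B0' B1']]]]].
  case: h => [|[|//]] _; rewrite ?B0 ?B1 ?B0' in_nil orFb.
    by rewrite !inE => /orP[] /eqP ->; rewrite eqxx ?orbT.
  by case: B1' => ->; rewrite !inE => /orP[] /eqP ->; rewrite eqxx ?orbT.
case: mv => xP [xQ [xR [kP [kQ [kR [ea [eb [ec]]]]]]]] /=.
case=> [[-> _] _ B0 [B1 B2] [B0' B1' B2']].
case: h => [|[|[|//]]] _; rewrite ?B0' ?B1' ?B2' mem_rev orbb ?B0 ?B1 ?B2;
  by case: ifP => _; rewrite !inE => /orP[] /eqP ->; rewrite eqxx ?orbT.
Qed.

Lemma local_move_transfer m B B' ids : local_move m B B' ids ->
  local_transfer m B B' /\ local_transfer m B' B.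
Proof.
case=> -[-> mv]; first exact: move1_transfer mv.
  exact: move2_transfer mv.
exact: move3_transfer mv.
Qed.

(** * Invariance under elementary steps and under equivalence *)

Lemma quandle_iso_refl Q : quandle_iso Q Q.
Proof. by exists id; split=> //; exists id. Qed.

Lemma quandle_iso_sym Q Q' : quandle_iso Q Q' -> quandle_iso Q' Q.
Proof.
case=> f [[g fK gK] fM]; exists g; split; first by exists f.
by move=> a b; rewrite -{1}(gK a) -{1}(gK b) -fM fK.
Qed.

Lemma quandle_iso_trans Q1 Q2 Q3 :
  quandle_iso Q1 Q2 -> quandle_iso Q2 Q3 -> quandle_iso Q1 Q3.
Proof.
case=> f [fB fM] [g [gB gM]]; exists (g \o f); split; first exact: bij_comp.
by move=> a b; rewrite /= fM gM.
Qed.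

Lemma vstep_size D D' : vstep D D' -> size D = size D'.
Proof.
case=> _ _ [[m [T [B [B' [ids [_ _ _ [-> ->]]]]]]]|[c [k [lc ->]]]|/perm_size //|].
- by rewrite !size_map.
- by rewrite size_rot_comp.
- by case=> phi [_ ->]; rewrite size_map.
Qed.

Lemma vstep_iso D D' : vstep D D' -> quandle_iso (Qtilde D) (Qtilde D').
Proof.
(* The empty diagram has no arc to serve as a default and is treated apart: steps preserve the
   number of components, so both diagrams are empty. *)
move=> st; have := vstep_size st; case: (posnP (size D)) => [s0|sD _].
  rewrite s0 => /esym/size0nil ->; rewrite (size0nil s0).
  exact: quandle_iso_refl.
case: st => wfD wfD' [[m [T [B [B' [ids [mv okT fT [eD eD']]]]]]]
  |[c [k [lc eD']]]||[phi [phiI eD']]].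
- subst; rewrite size_map in sD.
  have [lt lt'] := local_move_transfer mv.
  apply: fill_iso okT fT _ _ lt lt' => // h lh p Bp; apply: local_move_ids mv lh _;
    by rewrite Bp ?orbT.
- by subst; exact: rot_iso.
- exact: perm_iso.
- exact: rename_iso eD'.
Qed.

Theorem theorem4 (D D' : diagram) :
  vequiv D D' -> quandle_iso (Qtilde D) (Qtilde D').
Proof.
elim=> {D D'} [D D'|D|D D' _|D1 D2 D3 _ iso12 _ iso23].
- exact: vstep_iso.
- exact: quandle_iso_refl.
- exact: quandle_iso_sym.
- exact: quandle_iso_trans iso12 iso23.
Qed.
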